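(* Let $\kappa$ be an infinite cardinal that is completely characterizable and satisfies $\kappa^{\aleph_0}=\kappa$. Then $\kappa$ is homogeneously characterizable.
   Context: All languages are countable; $L_{\omega_1,\omega}$ allows countable conjunctions/disjunctions and finite quantification. A sentence $\sigma\in L_{\omega_1,\omega}$ is complete if for every $L_{\omega_1,\omega}$-sentence $\tau$, either $\sigma\Rightarrow\tau$ or $\sigma\Rightarrow\neg\tau$ is valid. An infinite cardinal $\kappa$ is completely characterizable if there is a complete $L_{\omega_1,\omega}$-sentence with models in all infinite cardinalities $\le\kappa$ and no model of cardinality $\kappa^+$. A unary predicate $P$ is completely homogeneous for a structure $\mathcal A$ if $P^{\mathcal A}$ is infinite and every permutation of $P^{\mathcal A}$ extends to an automorphism of $\mathcal A$. The cardinal $\kappa$ is homogeneously characterizable if there are a complete $L_{\omega_1,\omega}$-sentence $\phi_\kappa$ and a unary predicate $P_\kappa$ in its language such that: $\phi_\kappa$ has no model of cardinality $>\kappa$; in the unique countable model $\mathcal M$ of $\phi_\kappa$, $P_\kappa$ is infinite and completely homogeneous for $\mathcal M$; and there is a model $\mathcal A$ of $\phi_\kappa$ with $|P_\kappa^{\mathcal A}|=\kappa$. *)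

(* Defs.v *)
From mathcomp Require Import all_boot.

Set Implicit Arguments.
Unset Strict Implicit.
Unset Printing Implicit Defensive.

Definition card_le (A B : Type) : Prop := exists f : A -> B, injective f.
Definition card_eq (A B : Type) : Prop := exists f : A -> B, bijective f.
Definition infinite_type (A : Type) : Prop := card_le nat A.
Definition card_lt (A B : Type) : Prop := card_le A B /\ ~ card_le B A.
Definition is_succ_card (K L : Type) : Prop :=
  card_lt K L /\ forall X : Type, card_lt K X -> card_le L X.

Record signature := Signature {
  fsym : Type;
  rsym : Type;
  farity : fsym -> nat;
  rarity : rsym -> nat;
  fsym_countable : card_le fsym nat;
  rsym_countable : card_le rsym nat }.

Section InfinitaryLogic.
Variable S : signature.

Inductive term : Type :=
  | Var : nat -> term
  | App : forall f : fsym S, ('I_(farity f) -> term) -> term.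

Inductive formula : Type :=
  | FEq : term -> term -> formula
  | FRel : forall r : rsym S, ('I_(rarity r) -> term) -> formula
  | FNeg : formula -> formula
  | FAnd : (nat -> formula) -> formula
  | FOr : (nat -> formula) -> formula
  | FEx : nat -> formula -> formula
  | FAll : nat -> formula -> formula.

Fixpoint occurs (v : nat) (t : term) : Prop :=
  match t with
  | Var n => n = v
  | App f a => exists i, occurs v (a i)
  end.

Fixpoint free_in (v : nat) (p : formula) : Prop :=
  match p with
  | FEq t1 t2 => occurs v t1 \/ occurs v t2
  | FRel r a => exists i, occurs v (a i)
  | FNeg q => free_in v q
  | FAnd qs => exists n, free_in v (qs n)
  | FOr qs => exists n, free_in v (qs n)
  | FEx x q => x <> v /\ free_in v q
  | FAll x q => x <> v /\ free_in v q
  end.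

Definition sentence (p : formula) : Prop := forall v, ~ free_in v p.

Record structure := Structure {
  dom : Type;
  dom_inh : dom;
  funs : forall f : fsym S, ('I_(farity f) -> dom) -> dom;
  rels : forall r : rsym S, ('I_(rarity r) -> dom) -> Prop }.

Fixpoint eval (M : structure) (rho : nat -> dom M) (t : term) : dom M :=
  match t with
  | Var n => rho n
  | App f a => @funs M f (fun i => eval rho (a i))
  end.

Definition upd (M : structure) (rho : nat -> dom M) (x : nat) (d : dom M) :
  nat -> dom M := fun n => if n == x then d else rho n.

Fixpoint sat (M : structure) (rho : nat -> dom M) (p : formula) : Prop :=
  match p with
  | FEq t1 t2 => eval rho t1 = eval rho t2
  | FRel r a => @rels M r (fun i => eval rho (a i))
  | FNeg q => ~ sat rho q
  | FAnd qs => forall n, sat rho (qs n)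
  | FOr qs => exists n, sat rho (qs n)
  | FEx x q => exists d, sat (upd rho x d) q
  | FAll x q => forall d, sat (upd rho x d) q
  end.

Definition models (M : structure) (p : formula) : Prop :=
  forall rho : nat -> dom M, sat rho p.

Definition implies_valid (sigma tau : formula) : Prop :=
  forall M : structure, models M sigma -> models M tau.

Definition complete_sentence (sigma : formula) : Prop :=
  sentence sigma /\
  forall tau, sentence tau ->
    implies_valid sigma tau \/ implies_valid sigma (FNeg tau).

Definition pred_interp (M : structure) (P : rsym S) : dom M -> Prop :=
  fun x => @rels M P (fun _ => x).

Definition automorphism (M : structure) (h : dom M -> dom M) : Prop :=
  bijective h /\
  (forall f (a : 'I_(farity f) -> dom M), h (@funs M f a) = @funs M f (fun i => h (a i))) /\
  (forall r (a : 'I_(rarity r) -> dom M), @rels M r a <-> @rels M r (fun i => h (a i))).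

Definition completely_homogeneous (M : structure) (P : rsym S) : Prop :=
  infinite_type {x : dom M | @pred_interp M P x} /\
  forall pi : {x : dom M | @pred_interp M P x} -> {x : dom M | @pred_interp M P x},
    bijective pi ->
    exists h, @automorphism M h /\
      forall x : {x : dom M | @pred_interp M P x}, h (proj1_sig x) = proj1_sig (pi x).

End InfinitaryLogic.

(* The cardinal kappa is represented by (the cardinality of) a type K. *)

Definition completely_characterizable (K : Type) : Prop :=
  exists (S : signature) (sigma : formula S),
    complete_sentence sigma /\
    (forall X : Type, infinite_type X -> card_le X K ->
       exists M : structure S, models M sigma /\ card_eq (dom M) X) /\
    (forall L : Type, is_succ_card K L ->
       ~ exists M : structure S, models M sigma /\ card_eq (dom M) L).

Definition homogeneously_characterizable (K : Type) : Prop :=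
  exists (S : signature) (phi : formula S) (P : rsym S),
    rarity P = 1 /\
    complete_sentence phi /\
    (forall M : structure S, models M phi -> ~ card_lt K (dom M)) /\
    (* the unique countable model: it exists, and P is infinite and
       completely homogeneous in it *)
    (exists M : structure S, models M phi /\ card_eq (dom M) nat) /\
    (forall M : structure S, models M phi -> card_eq (dom M) nat ->
       completely_homogeneous M P) /\
    (exists A : structure S, models A phi /\
       card_eq {x : dom A | pred_interp P x} K).

(* Main.v *)
(* For a model M of the given complete sentence sigma, let the expansion of M consist of M,
   of a second copy P of its domain, and of the branches: sequences of finite subsets of M
   that are eventually equal to a singleton {c}; c is the colour of the branch, read in P.
   On branches one keeps only their colours, the relations "agree below level n", and, for
   two branches that agree below n, the finite symmetric difference of their n-th terms.
   The type of a branch over finitely many others is then determined by its splitting with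
   a closest one, and every node of the tree contains branches of every colour. So a
   back-and-forth system between models M and N, together with an arbitrary one between
   the pure sets P, lifts to the expansions. Taking the identity on the countable model N
   and any permutation of P shows that P is completely homogeneous; comparing the model of
   cardinality kappa with N shows that its expansion satisfies the Scott sentence phi of
   the expansion of N.
   In a model of phi the base has cardinality at most kappa: otherwise a subset of
   cardinality kappa^+, closed under the witnesses of a back-and-forth system with N, would
   be a model of sigma. Choosing a representative of each class of "agree below n" codes a
   branch by a sequence of finite subsets of the base, so there are at most
   kappa^aleph_0 = kappa branches; and every element of P is a colour. *)

From mathcomp Require Import all_boot.
From mathcomp Require Import boolp.
From mathcomp Require wochoice.
From Stdlib Require List.
Require Import Defs.

Set Implicit Arguments.
Unset Strict Implicit.
Unset Printing Implicit Defensive.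

Local Notation In := List.In.

(** * Back-and-forth systems and Scott sentences *)

Lemma mem_In (T : eqType) (x : T) (s : seq T) : x \in s -> In x s.
Proof.
elim: s => //= y s IH; rewrite in_cons => /orP[/eqP->|/IH]; [by left|by right].
Qed.

Lemma In_map (T U : Type) (f : T -> U) (s : seq T) (y : U) :
  In y (map f s) <-> exists2 x, In x s & y = f x.
Proof.
elim: s => [|z s IH] /=; first by split=> [|[]].
split=> [[<-|/(proj1 IH)[x xs ->]]|[x [->|xs] e]].
- by exists z => //; left.
- by exists x => //; right.
- by left.
- by right; apply: (proj2 IH); exists x.
Qed.

Definition swap (T U : Type) (p : T * U) : U * T := (p.2, p.1).

Lemma map_swapK (T U : Type) (s : seq (T * U)) : map (@swap U T) (map (@swap T U) s) = s.
Proof. by elim: s => [|[x y] s IH] //=; rewrite IH. Qed.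

Lemma In_swap (T U : Type) (s : seq (T * U)) x y :
  In (y, x) (map (@swap T U) s) <-> In (x, y) s.
Proof.
split=> [/In_map[[a b] ab [-> ->]] //|xy]; by apply/In_map; exists (x, y).
Qed.

Section PartialIsomorphism.
Variables (R : Type) (ar : R -> nat).
Implicit Types (X Y : Type).

(** Relations on a bare type and not on a structure, so that back-and-forth systems also apply to
    pure sets and to subsets on which no functions are given. *)
Definition interp X := forall r : R, ('I_(ar r) -> X) -> Prop.

(* A back-and-forth system: a set of finite partial isomorphisms, each given by
   the list of its pairs. *)
Record piso X Y (RX : interp X) (RY : interp Y) (I : seq (X * Y) -> Prop) : Prop := Piso {
  piso_nil : I [::];
  piso_forth : forall s x, I s -> exists y, I ((x, y) :: s);
  piso_back : forall s y, I s -> exists x, I ((x, y) :: s);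
  piso_eq : forall s x y x' y', I s -> In (x, y) s -> In (x', y') s -> x = x' <-> y = y';
  piso_rel : forall s r (v : 'I_(ar r) -> X * Y), I s -> (forall i, In (v i) s) ->
    RX r (fun i => (v i).1) <-> RY r (fun i => (v i).2) }.

Lemma piso_sym X Y (RX : interp X) (RY : interp Y) I :
  piso RX RY I -> piso RY RX (fun s => I (map (@swap Y X) s)).
Proof.
case=> n f b e r; split=> //.
- by move=> s x /(b _ x).
- by move=> s x /(f _ x).
- move=> s x y x' y' Is h h'; apply: iff_sym; apply: e Is _ _; exact/In_swap.
- move=> s q v Is h; apply: iff_sym; apply: (r _ q (fun i => swap (v i)) Is) => i.
  by apply/In_map; exists (v i).
Qed.

Lemma piso_list X Y (RX : interp X) (RY : interp Y) I (l : seq X) s :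
  piso RX RY I -> I s ->
  exists s', [/\ I s', List.incl s s' & forall x, In x l -> exists y, In (x, y) s'].
Proof.
move=> PI Is; elim: l => [|x l [s' [Is' ss' h]]]; first by exists s; split.
have [y Iy] := piso_forth PI x Is'.
exists ((x, y) :: s'); split=> //.
- exact: List.incl_tl.
- by move=> z /= [<-|/h[w hw]]; [exists y; left|exists w; right].
Qed.

Lemma piso_list_back X Y (RX : interp X) (RY : interp Y) I (l : seq Y) s :
  piso RX RY I -> I s ->
  exists s', [/\ I s', List.incl s s' & forall y, In y l -> exists x, In (x, y) s'].
Proof.
move=> PI Is; have [|s' [Is' ss' h]] := piso_list l (piso_sym PI) (s := map (@swap X Y) s).
  by rewrite map_swapK.
exists (map (@swap Y X) s'); split=> // [[x y] /In_swap/ss'/In_swap //|y /h[x hx]].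
by exists x; apply/In_swap.
Qed.

Lemma piso_tuple X Y (RX : interp X) (RY : interp Y) I n (x : 'I_n -> X) s :
  piso RX RY I -> I s ->
  exists s' (y : 'I_n -> Y), [/\ I s', List.incl s s' & forall i, In (x i, y i) s'].
Proof.
move=> PI Is; have [s' [Is' ss' h]] := piso_list (map x (enum 'I_n)) PI Is.
have /choice[y hy] : forall i, exists y, In (x i, y) s'.
  by move=> i; apply: h; apply/In_map; exists i => //; apply: mem_In; rewrite mem_enum.
by exists s', y.
Qed.

(* The union of a chain of finite partial isomorphisms that alternately meets the
   two enumerations. *)
Lemma piso_countable X Y (RX : interp X) (RY : interp Y) I (e : nat -> X) (e' : nat -> Y) :
  piso RX RY I -> (forall x, exists n, e n = x) -> (forall y, exists n, e' n = y) ->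
  exists h : X -> Y, [/\ bijective h,
    forall r (a : 'I_(ar r) -> X), RX r a <-> RY r (fun i => h (a i)) &
    forall x, exists2 s, I s & In (x, h x) s].
Proof.
move=> PI se se'.
have step (n : nat) (s : {s | I s}) : {s' : {s | I s} | [/\ List.incl (sval s) (sval s'),
    exists y, In (e n, y) (sval s') & exists x, In (x, e' n) (sval s')]}.
  apply: cid; case: s => s Is.
  have [y Iy] := piso_forth PI (e n) Is; have [x Ix] := piso_back PI (e' n) Iy.
  exists (exist _ _ Ix); split=> /=.
  - by move=> p ps; right; right.
  - by exists y; right; left.
  - by exists x; left.
pose c := fix c n := if n is n'.+1 then sval (step n' (c n')) else exist I [::] (piso_nil PI).
have cI n : I (sval (c n)) by case: (c n).
have cS m n : m <= n -> List.incl (sval (c m)) (sval (c n)).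
  elim: n => [|n IH]; first by rewrite leqn0 => /eqP->; exact: List.incl_refl.
  rewrite leq_eqVlt => /orP[/eqP->|]; first exact: List.incl_refl.
  rewrite ltnS => /IH h; apply: List.incl_tran h _ => /=.
  by case: (step n (c n)) => s' [].
have ce n : exists y, In (e n, y) (sval (c n.+1)) by rewrite /=; case: (step n (c n)) => s' [].
have ce' n : exists x, In (x, e' n) (sval (c n.+1)) by rewrite /=; case: (step n (c n)) => s' [].
have /choice[h hh] : forall x, exists y, exists n, In (x, y) (sval (c n)).
  by move=> x; have [n <-] := se x; have [y] := ce n; exists y, n.+1.
have /choice[g hg] : forall y, exists x, exists n, In (x, y) (sval (c n)).
  by move=> y; have [n <-] := se' y; have [x] := ce' n; exists x, n.+1.
have ceq x y x' y' : (exists n, In (x, y) (sval (c n))) -> (exists n, In (x', y') (sval (c n))) ->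
    x = x' <-> y = y'.
  move=> [n h1] [m h2]; apply: (piso_eq PI (cI (maxn n m))); apply: cS; first exact: leq_maxl.
  - exact: h1.
  - exact: leq_maxr.
  - exact: h2.
exists h; split.
- exists g => [x|y]; first by apply/(ceq _ (h x) _ (h x)).
  by apply/(ceq (g y) _ (g y)).
- move=> r a.
  have /choice[f hf] : forall i, exists n, In (a i, h (a i)) (sval (c n)) by move=> i.
  apply: (piso_rel PI (v := fun i => (a i, h (a i))) (cI (\max_i f i))) => i.
  by apply: cS (hf i); exact: leq_bigmax.
- by move=> x; have [n] := hh x; exists (sval (c n)).
Qed.

End PartialIsomorphism.

(** * Invariance of infinitary formulas under back-and-forth systems *)

Section Scott.
Variable S : signature.
Implicit Types (A B M N : structure S) (p q : formula S).

Definition atom := (rsym S + fsym S)%type.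

Definition atom_arity (r : atom) : nat :=
  match r with inl r => rarity r | inr f => (farity f).+1 end.

(* A function symbol is read as its graph, the value being the argument number 0. *)
Definition holds A : interp atom_arity (dom A) := fun r =>
  match r return ('I_(atom_arity r) -> dom A) -> Prop with
  | inl r => fun v => @rels S A r v
  | inr f => fun v => @funs S A f (fun i => v (lift ord0 i)) = v ord0
  end.

Definition graph_arg X n (c : X) (x : 'I_n -> X) : 'I_n.+1 -> X :=
  fun j => if unlift ord0 j is Some i then x i else c.

Lemma graph_arg0 X n (c : X) (x : 'I_n -> X) : graph_arg c x ord0 = c.
Proof. by rewrite /graph_arg unlift_none. Qed.

Lemma graph_argS X n (c : X) (x : 'I_n -> X) i : graph_arg c x (lift ord0 i) = x i.
Proof. by rewrite /graph_arg liftK. Qed.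

Lemma holds_graph A f (x : 'I_(farity f) -> dom A) c :
  @holds A (inr f) (graph_arg c x) <-> funs x = c.
Proof.
rewrite /= graph_arg0; have -> // : (fun i => graph_arg c x (lift ord0 i)) = x.
by apply: funext => i; rewrite graph_argS.
Qed.

Definition piso_struct A B := piso (@holds A) (@holds B).

(** The left side carries relations only: this is the form needed to recover functions from
    relations that are matched with graphs. *)
Lemma piso_graph X (RX : interp atom_arity X) B I s f (x : 'I_(farity f) -> X) y c d :
  piso RX (@holds B) I -> I s -> (forall i, In (x i, y i) s) -> In (c, d) s ->
  RX (inr f) (graph_arg c x) <-> funs y = d.
Proof.
move=> PI Is h hc.
have := piso_rel PI (r := inr f) (v := graph_arg (c, d) (fun i => (x i, y i))) Is.
have -> : (fun i => (graph_arg (c, d) (fun i => (x i, y i)) i).1) = graph_arg c x.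
  by apply: funext => i; rewrite /graph_arg; case: unliftP.
have -> : (fun i => (graph_arg (c, d) (fun i => (x i, y i)) i).2) = graph_arg d y.
  by apply: funext => i; rewrite /graph_arg; case: unliftP.
rewrite holds_graph; apply => i; rewrite /graph_arg; by case: unliftP.
Qed.

Lemma piso_funs A B I s f (x : 'I_(farity f) -> dom A) y c d :
  @piso_struct A B I -> I s -> (forall i, In (x i, y i) s) -> In (c, d) s ->
  funs x = c <-> funs y = d.
Proof. by move=> PI Is h hc; rewrite -(piso_graph PI Is h hc) holds_graph. Qed.

(** The values of subterms need not occur in [s]; they are adjoined by the forth property, and the
    graph relations then identify their partners. *)
Lemma piso_eval A B I rA rB t s b :
  @piso_struct A B I -> I s -> (forall v, occurs v t -> In (rA v, rB v) s) ->
  In (eval rA t, b) s -> b = eval rB t.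
Proof.
move=> PI; elim: t s b => [n|f a IH] s b Is /= hv hb.
  by apply/(piso_eq PI Is hb (hv n erefl)).
have [s' [y [Is' ss' hy]]] := piso_tuple (fun i => eval rA (a i)) PI Is.
have -> : (fun i => eval rB (a i)) = y.
  apply: funext => i; apply/esym/(IH i s') => // v hv'; apply: ss'; apply: hv; by exists i.
by apply/esym/(piso_funs PI Is' hy (ss' _ hb)).
Qed.

(** Karp's theorem: quantifiers are handled by the forth and back properties, which extend [s] by
    the new value. Only free variables have to be matched, so a sentence can start from the empty
    list. *)
Theorem piso_sat A B I p s rA rB :
  @piso_struct A B I -> I s -> (forall v, free_in v p -> In (rA v, rB v) s) ->
  sat rA p <-> sat rB p.
Proof.
move=> PI; elim: p s rA rB => [t1 t2|r a|q IH|qs IH|qs IH|x q IH|x q IH] s rA rB Is /= hv.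
- have [b1 I1] := piso_forth PI (eval rA t1) Is.
  have [b2 I2] := piso_forth PI (eval rA t2) I1.
  have e1 : b1 = eval rB t1.
    by apply: (piso_eval PI I1) => [v hv'|]; [right; apply: hv; left|left].
  have e2 : b2 = eval rB t2.
    by apply: (piso_eval PI I2) => [v hv'|]; [right; right; apply: hv; right|left].
  by rewrite -e1 -e2; apply: (piso_eq PI I2); [right; left|left].
- have [s' [y [Is' ss' hy]]] := piso_tuple (fun i => eval rA (a i)) PI Is.
  have -> : (fun i => eval rB (a i)) = y.
    apply: funext => i; apply/esym/(piso_eval PI Is') => // v hv'.
    by apply: ss'; apply: hv; exists i.
  exact: (piso_rel PI (r := inl r) (v := fun i => (eval rA (a i), y i)) Is' hy).
- by have := IH s rA rB Is hv; tauto.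
- have e n : sat rA (qs n) <-> sat rB (qs n) by apply: IH Is _ => v hv'; apply: hv; exists n.
  by split=> h n; apply/e.
- have e n : sat rA (qs n) <-> sat rB (qs n) by apply: IH Is _ => v hv'; apply: hv; exists n.
  by split=> -[n h]; exists n; apply/e.
- have hu a b : I ((a, b) :: s) -> forall v, free_in v q ->
      In (upd rA x a v, upd rB x b v) ((a, b) :: s).
    move=> _ v hv'; rewrite /upd; case: eqP => [_|ne]; first by left.
    by right; apply: hv; split=> // e; apply: ne.
  split=> -[d hd].
  + have [b Ib] := piso_forth PI d Is; exists b; exact/(IH _ _ _ Ib (hu _ _ Ib)).
  + have [a Ia] := piso_back PI d Is; exists a; exact/(IH _ _ _ Ia (hu _ _ Ia)).
- have hu a b : I ((a, b) :: s) -> forall v, free_in v q ->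
      In (upd rA x a v, upd rB x b v) ((a, b) :: s).
    move=> _ v hv'; rewrite /upd; case: eqP => [_|ne]; first by left.
    by right; apply: hv; split=> // e; apply: ne.
  split=> hd d.
  + have [a Ia] := piso_back PI d Is; exact/(IH _ _ _ Ia (hu _ _ Ia)).
  + have [b Ib] := piso_forth PI d Is; exact/(IH _ _ _ Ib (hu _ _ Ib)).
Qed.

Corollary piso_models A B I p : @piso_struct A B I -> sentence p -> models A p <-> models B p.
Proof.
move=> PI sp; split=> h r.
- by apply/(piso_sat (rA := fun=> dom_inh A) PI (piso_nil PI)) => // v /sp.
- by apply/(piso_sat (rB := fun=> dom_inh B) PI (piso_nil PI)) => // v /sp.
Qed.

Lemma eval_ext A rA rB t : (forall v, occurs v t -> rA v = rB v) -> @eval S A rA t = eval rB t.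
Proof.
elim: t => [n|f a IH] /= h; first exact: h.
by congr funs; apply: funext => i; apply: IH => v hv; apply: h; exists i.
Qed.

Lemma sat_ext A rA rB p : (forall v, free_in v p -> rA v = rB v) -> @sat S A rA p -> sat rB p.
Proof.
elim: p rA rB => [t1 t2|r a|q IH|qs IH|qs IH|x q IH|x q IH] rA rB /= h.
- by rewrite (@eval_ext _ rA rB t1) ?(@eval_ext _ rA rB t2) // => v hv; apply: h; [right|left].
- suff -> : (fun i => eval rA (a i)) = (fun i => eval rB (a i)) by [].
  by apply: funext => i; apply: eval_ext => v hv; apply: h; exists i.
- by move=> hn hq; apply: hn; apply: IH hq => v /h.
- by move=> hq n; apply: IH (hq n) => v hv; apply: h; exists n.
- by move=> [n hq]; exists n; apply: IH hq => v hv; apply: h; exists n.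
- move=> [d hd]; exists d; apply: IH hd => v hv; rewrite /upd; case: eqP => // ne.
  by apply: h; split=> // e; apply: ne.
- move=> hd d; apply: IH (hd d) => v hv; rewrite /upd; case: eqP => // ne.
  by apply: h; split=> // e; apply: ne.
Qed.

Lemma sentence_sat A rA p : sentence p -> @sat S A rA p -> models A p.
Proof. by move=> sp h r; apply: sat_ext h => v /sp. Qed.

(** * Formulas over finite tuples, countable connectives and the Scott sentence *)

Definition below k p := forall v, free_in v p -> v < k.

Definition FTrue : formula S := FAll 0 (FEq (Var S 0) (Var S 0)).

Lemma below_FTrue k : below k FTrue.
Proof. by move=> v [h [] e]; case: (h e). Qed.

Definition FImp p q : formula S := FOr (fun n => if n is 0 then FNeg p else q).

Lemma sat_FImp A r p q : @sat S A r (FImp p q) <-> (sat r p -> sat r q).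
Proof.
split=> [[[|n] //=] | h].
have [/h hp|np] := EM (sat r p); first by exists 1.
by exists 0.
Qed.

Lemma below_FImp k p q : below k p -> below k q -> below k (FImp p q).
Proof. by move=> hp hq v [[|n] /=]; [apply: hp|apply: hq]. Qed.

Definition FAll_of (T : countType) (F : T -> formula S) : formula S :=
  FAnd (fun n => if @unpickle T n is Some t then F t else FTrue).
Definition FSome_of (T : countType) (F : T -> formula S) : formula S :=
  FOr (fun n => if @unpickle T n is Some t then F t else FNeg FTrue).

Lemma sat_FAll_of A r T F : @sat S A r (@FAll_of T F) <-> forall t, sat r (F t).
Proof.
by split=> [h t|h n /=]; [have := h (pickle t); rewrite pickleK|case: unpickle].
Qed.

Lemma sat_FSome_of A r T F : @sat S A r (@FSome_of T F) <-> exists t, sat r (F t).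
Proof.
split=> [[n /=]|[t h]]; last by exists (pickle t); rewrite pickleK.
by case: unpickle => [t h|h]; [exists t|case: h].
Qed.

Lemma below_FAll_of k T F : (forall t, below k (F t)) -> below k (@FAll_of T F).
Proof. by move=> h v [n /=]; case: unpickle => [t|]; [apply: h|apply: below_FTrue]. Qed.

Lemma below_FSome_of k T F : (forall t, below k (F t)) -> below k (@FSome_of T F).
Proof. by move=> h v [n /=]; case: unpickle => [t|]; [apply: h|apply: (@below_FTrue k)]. Qed.

Lemma below_quant k p : below k.+1 p -> below k (FAll k p) /\ below k (FEx k p).
Proof. by move=> h; split=> v /= [/eqP ne /h]; rewrite ltnS leq_eqVlt eq_sym (negbTE ne). Qed.

Fixpoint closure k p : formula S := if k is k'.+1 then closure k' (FAll k' p) else p.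

Lemma sentence_closure k p : below k p -> sentence (closure k p).
Proof. by elim: k p => [|k IH] p h /=; [move=> v /h|apply: IH; case: (below_quant h)]. Qed.

Lemma models_closure A k p : models A (closure k p) <-> models A p.
Proof.
elim: k p => //= k IH p; rewrite IH; split=> h r; last by move=> d; apply: h.
by apply: sat_ext (h r (r k)) => v _; rewrite /upd; case: eqP => [->|].
Qed.

Lemma atom_countable : card_le atom nat.
Proof.
have [cf hf] := fsym_countable S; have [cr hr] := rsym_countable S.
exists (fun a => match a with inl r => (cr r).*2 | inr f => (cf f).*2.+1 end).
move=> [r|f] [r'|f'] e.
- by congr inl; apply: hr; rewrite -[LHS]doubleK e doubleK.
- by move: (congr1 odd e); rewrite /= !odd_double.
- by move: (congr1 odd e); rewrite /= !odd_double.
- by congr inr; apply: hf; case: e => e; rewrite -[LHS]doubleK e doubleK.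
Qed.

Definition atom_form (r : atom) : ('I_(atom_arity r) -> nat) -> formula S :=
  match r return ('I_(atom_arity r) -> nat) -> formula S with
  | inl r => fun g => FRel (r := r) (fun i => Var S (g i))
  | inr f => fun g => FEq (App (f := f) (fun i => Var S (g (lift ord0 i)))) (Var S (g ord0))
  end.

Lemma sat_atom_form A rA (r : atom) (g : 'I_(atom_arity r) -> nat) :
  @sat S A rA (atom_form g) <-> holds (fun i => rA (g i)).
Proof. by case: r g. Qed.

Lemma below_atom_form k (r : atom) (g : 'I_(atom_arity r) -> nat) :
  (forall i, g i < k) -> below k (atom_form g).
Proof. by case: r g => [r|f] g h v /= => [[i <-]|[[i <-]|<-]]. Qed.

Lemma atoms_enumerated : exists (T : countType) (F : T -> formula S),
  (forall i j, exists t, F t = FEq (Var S i) (Var S j)) /\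
  (forall r (g : 'I_(atom_arity r) -> nat), exists t, F t = atom_form g).
Proof.
have [c hc] := atom_countable.
(* The pair [(m, l)] stands for the symbol coded by [m], applied to the variables listed in [l]; a
   number coding no symbol gives [FTrue]. *)
pose F (t : nat * nat + nat * seq nat) : formula S := match t with
  | inl (i, j) => FEq (Var S i) (Var S j)
  | inr (m, l) => if pselect (exists r, c r = m) is left h
      then atom_form (fun i : 'I_(atom_arity (sval (cid h))) => nth 0 l i) else FTrue
  end.
exists (nat * nat + nat * seq nat)%type, F; split=> [i j|r g]; first by exists (inl (i, j)).
exists (inr (c r, map g (enum 'I_(atom_arity r)))) => /=.
case: pselect => [h|]; last by case; exists r.
case: cid => r' /= /hc e; subst r'; congr atom_form; apply: funext => i.
by rewrite (nth_map i) ?size_enum_ord // nth_ord_enum.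
Qed.

(** As [N] is countable, the type of each of its tuples is isolated within [N] by one formula.
    [theta] says that the empty tuple has its type, and that each isolating formula forces the
    atomic facts of its tuple and exactly the one-point extensions found in [N]. *)
Theorem scott_sentence N (e : nat -> dom N) : (forall x, exists n, e n = x) ->
  exists theta, sentence theta /\
    forall B, models B theta <-> exists I, @piso_struct B N I.
Proof.
move=> se.
pose vl (l : seq nat) i := e (nth 0 l i).
have vlP k (r : nat -> dom N) : exists2 l, size l = k & forall i, i < k -> r i = vl l i.
  have /choice[c hc] : forall i, exists n, e n = r i by move=> i; apply: se.
  by exists (mkseq c k); rewrite ?size_mkseq // => i ik; rewrite /vl nth_mkseq.
have vlS l j i : i < (size l).+1 -> upd (vl l) (size l) (e j) i = vl (rcons l j) i.
  by rewrite /vl /upd nth_rcons ltnS leq_eqVlt => /orP[/eqP->|]; rewrite ?eqxx ?ltnn //;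
     move=> h; rewrite h ltn_eqF.
(* [th l] isolates, among the tuples of [N], the type of the tuple coded by [l]. *)
have /choice[th thP] : forall l, exists t : formula S, [/\ below (size l) t,
    sat (vl l) t & forall l' q, size l' = size l -> below (size l) q ->
      sat (vl l') t -> sat (vl l) q -> sat (vl l') q].
  move=> l.
  (* [d l'] is true of [l] and false of [l'] if some formula separates them; otherwise any true
     formula will do. The conjunction of all [d l'] is countable. *)
  have /choice[d hd] : forall l', exists q, [/\ below (size l) q, sat (vl l) q &
      forall q', below (size l) q' -> sat (vl l') q -> sat (vl l) q' -> sat (vl l') q'].
    move=> l'.
    have [[q hq]|no] := EM (exists q, [/\ below (size l) q, sat (vl l) q & ~ sat (vl l') q]).
      by exists q; case: hq => ? ? ?; split.
    exists FTrue; split=> // [|q' bq' _ hq']; first exact: below_FTrue.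
    by apply: contrapT => nq; apply: no; exists q'.
  exists (FAll_of d); split.
  - by apply: below_FAll_of => l'; case: (hd l').
  - by apply/sat_FAll_of => l'; case: (hd l').
  - move=> l' q _ bq /sat_FAll_of/(_ l') h hq; by case: (hd l') => _ _; apply.
have [T [F [FE FA]]] := atoms_enumerated.
(* Three kinds of conjuncts: every further element realizes some extension found in [N]; each such
   extension is realized; the atomic facts about the tuple hold. Atoms mentioning variables outside
   the tuple are replaced by [FTrue]. *)
pose body_part (l : seq nat) (c : unit + (nat + T)) : formula S := match c with
  | inl tt => FAll (size l) (FSome_of (fun j : nat => th (rcons l j)))
  | inr (inl j) => FEx (size l) (th (rcons l j))
  | inr (inr t) => if ~~ `[< below (size l) (F t) >] then FTrue
                   else if `[< sat (vl l) (F t) >] then F t else FNeg (F t)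
  end.
pose body l := FAll_of (body_part l).
have bth l j : below (size l).+1 (th (rcons l j)).
  by rewrite -(size_rcons l j); case: (thP (rcons l j)).
have bbody l : below (size l) (body l).
  apply: below_FAll_of => -[[]|[j|t]].
  - exact: (proj1 (below_quant (below_FSome_of (bth l)))).
  - exact: (proj2 (below_quant (bth l j))).
  - rewrite /=; case: asboolP => bt /=; last exact: below_FTrue.
    by case: asboolP.
have satbody l : sat (vl l) (body l).
  apply/sat_FAll_of => -[[]|[j|t]].
  - move=> d; apply/sat_FSome_of; have [j <-] := se d; exists j.
    have [_ + _] := thP (rcons l j); apply: sat_ext => v /bth hv; by rewrite vlS.
  - exists (e j); have [_ + _] := thP (rcons l j); apply: sat_ext => v /bth hv; by rewrite vlS.
  - rewrite /=; case: asboolP => bt //=; by case: asboolP.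
pose part (c : option (seq nat)) : formula S :=
  if c is Some l then closure (size l) (FImp (th l) (body l)) else th [::].
pose theta : formula S := FAll_of part.
have bth0 l : below (size l) (th l) by case: (thP l).
have stheta : sentence theta.
  have : below 0 theta.
    apply: below_FAll_of => -[l v|]; last exact: bth0.
    by move=> /sentence_closure[]; exact: below_FImp.
  by move=> h v /h.
have Ntheta : models N theta.
  move=> r; apply/sat_FAll_of => -[l|]; last first.
    by have [h0 + _] := thP [::]; apply: sat_ext => v /h0.
  apply: (proj2 (models_closure N (size l) (FImp (th l) (body l)))) => {}r.
  have [l' sl' hl'] := vlP (size l) r.
  have bI : below (size l) (FImp (th l) (body l)) by apply: below_FImp.
  apply: (@sat_ext _ (vl l')) => [v /bI /hl' -> //|].
  (* [body l] is true of [l], and [th l] implies in [N] every formula true of [l]. *)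
  apply/sat_FImp => h; by have [_ _] := thP l; apply.
exists theta; split=> // B; split=> [hB|[I PI]]; last by apply/(piso_models PI).
have hB0 (r : nat -> dom B) : sat r (th [::]).
  exact: (proj1 (@sat_FAll_of B r _ part) (hB r) None).
have hBl l (r : nat -> dom B) : sat r (th l) -> forall c, sat r (body_part l c).
  have h : models B (closure (size l) (FImp (th l) (body l))).
    by move=> r'; exact: (proj1 (@sat_FAll_of B r' _ part) (hB r') (Some l)).
  move/models_closure: h => /(_ r)/sat_FImp h /h hb c.
  exact: (proj1 (@sat_FAll_of B r _ (body_part l)) hb c).
(* The system pairs corresponding entries of a tuple of [N] and of a tuple of [B] that satisfies the
   isolating formula of the former. *)
exists (fun s => exists l (r : nat -> dom B), sat r (th l) /\
  forall w, In w s -> exists2 i, i < size l & w = (r i, vl l i)).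
have ext (s : seq (dom B * dom N)) l (r : nat -> dom B) x j :
    (forall w, In w s -> exists2 i, i < size l & w = (r i, vl l i)) ->
    forall w, In w ((x, e j) :: s) -> exists2 i, i < size (rcons l j) &
      w = (upd r (size l) x i, vl (rcons l j) i).
  move=> h p /= [<-|/h[i il ->]].
    by exists (size l); rewrite ?size_rcons // /upd /vl nth_rcons ltnn eqxx.
  exists i; first by rewrite size_rcons leqW.
  by rewrite /upd /vl nth_rcons il ltn_eqF.
split.
- by exists [::], (fun=> dom_inh B); split=> //; apply: hB0.
- move=> s x [l [r [/hBl hb hs]]].
  have /sat_FSome_of[j hj] := hb (inl tt) x.
  exists (e j), (rcons l j), (upd r (size l) x); split=> //; exact: ext.
- move=> s y [l [r [/hBl hb hs]]]; have [j <-] := se y.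
  have [x hx] := hb (inr (inl j)).
  exists x, (rcons l j), (upd r (size l) x); split=> //; exact: ext.
- move=> s x y x' y' [l [r [/hBl hb hs]]] /hs[i il [-> ->]] /hs[j jl [-> ->]].
  have [t ht] := FE i j; have := hb (inr (inr t)); rewrite /= ht.
  rewrite asboolT /=; last by move=> v [<-|<-].
  by case: asboolP => /= ?; split.
- move=> s q v [l [r [/hBl hb hs]]] hv.
  have /choice[g hg] : forall i, exists k, k < size l /\ v i = (r k, vl l k).
    by move=> i; have [k] := hs _ (hv i); exists k.
  have -> : v = (fun i => (r (g i), vl l (g i))) by apply: funext => i; case: (hg i).
  have [t ht] := FA q g; have := hb (inr (inr t)); rewrite /= ht.
  rewrite asboolT /=; last by apply: below_atom_form => i; case: (hg i).
  rewrite -(sat_atom_form r g) -(sat_atom_form (vl l) g); by case: asboolP => /= ? ?; split.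
Qed.

End Scott.

(** * Coloured branches *)

Definition agree T i (x y : nat -> T -> bool) := forall j, j < i -> x j = y j.

Lemma agree_sym T i (x y : nat -> T -> bool) : agree i x y -> agree i y x.
Proof. by move=> h j /h. Qed.

Lemma agree_trans T i (x y z : nat -> T -> bool) : agree i x y -> agree i y z -> agree i x z.
Proof. by move=> h h' j ji; rewrite h ?h'. Qed.

Lemma agree_le T i j (x y : nat -> T -> bool) : i <= j -> agree j x y -> agree i x y.
Proof. by move=> ij h k ki; apply: h; apply: leq_trans ki ij. Qed.

Lemma agreeS T i (x y : nat -> T -> bool) :
  agree i.+1 x y <-> agree i x y /\ forall m, x i m = y i m.
Proof.
split=> [h|[h e] j]; first by split=> [|m]; [apply: agree_le h|rewrite h].
by rewrite ltnS leq_eqVlt => /orP[/eqP->|/h //]; apply: funext.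
Qed.

Section Branch.
Variable T : Type.

Definition colour (x : nat -> T -> bool) (c : T) :=
  exists k, forall n, k <= n -> forall m, x n m = `[< m = c >].

Lemma colour_uniq x c c' : colour x c -> colour x c' -> c = c'.
Proof.
move=> [k h] [k' h']; have := h (maxn k k') (leq_maxl _ _) c.
by rewrite (h' _ (leq_maxr _ _)) (asboolT (erefl c)) => /asboolP.
Qed.

(* A branch is a sequence of finite subsets of [T], eventually equal to the
   singleton of its colour. *)
Definition branch := {x : nat -> T -> bool |
  (exists L, forall n m, x n m -> In m L) /\ exists c, colour x c}.

Lemma branch_inj (x y : branch) : (forall n m, sval x n m = sval y n m) -> x = y.
Proof.
case: x y => [x hx] [y hy] /= e; have exy : x = y by apply: funext => n; apply: funext => m.
by subst y; congr exist; apply: Prop_irrelevance.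
Qed.

Lemma branch_agree (x y : branch) : (forall i, agree i (sval x) (sval y)) -> x = y.
Proof. by move=> h; apply: branch_inj => n m; rewrite (h n.+1). Qed.

Lemma branch_split (x y : branch) : x <> y ->
  exists n m, agree n (sval x) (sval y) /\ sval x n m (+) sval y n m.
Proof.
move=> ne; have ex : exists i, ~~ `[< agree i (sval x) (sval y) >].
  apply: contrapT => no; apply: ne; apply: branch_agree => i.
  by apply: contrapT => na; apply: no; exists i; apply/asboolPn.
case: (ex_minnP ex) => -[|n] /asboolPn na mini; first by case: na.
have a : agree n (sval x) (sval y).
  by apply: contrapT => /asboolPn/mini; rewrite ltnn.
apply: contrapT => no; apply: na; apply/agreeS; split=> // m.
apply: contrapT => d; apply: no; exists n, m; split=> //.
by case: (sval x n m) d; case: (sval y n m).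
Qed.

(** The branch follows [x] below level [i], differs from it by [f] at level [i], and is the
    singleton of [c] afterwards. The colour depends only on the tail, so [c] is arbitrary. *)
Lemma branch_dense (x : nat -> T -> bool) (L : seq T) i (f : T -> bool) (L' : seq T) c :
  (forall n m, x n m -> In m L) -> (forall m, f m -> In m L') ->
  exists y : branch, [/\ agree i (sval y) x, forall m, sval y i m = x i m (+) f m &
    colour (sval y) c].
Proof.
move=> hL hL'.
pose y j m := if j < i then x j m else if j == i then x i m (+) f m else `[< m = c >].
have hy : (exists L, forall n m, y n m -> In m L) /\ exists c, colour y c.
  split.
    exists (c :: L ++ L') => n m; rewrite /y; case: ifP => [_ /hL h|_].
      by right; apply/List.in_app_iff; left.
    case: ifP => [_|_ /asboolP ->]; last by left.
    case xm : (x i m) => /=; first by move=> _; right; apply/List.in_app_iff; left; apply: hL xm.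
    by move=> /hL' h; right; apply/List.in_app_iff; right.
  exists c, i.+1 => n hn m; rewrite /y ltnNge (ltnW hn) /=; case: eqP => // e.
  by rewrite e ltnn in hn.
exists (exist _ y hy); split => [j ji|m|]; rewrite /= /y.
- by apply: funext => m; rewrite ji.
- by rewrite ltnn eqxx.
- by case: hy => _ [c' hc']; exists i.+1 => n hn m; rewrite ltnNge (ltnW hn) /= gtn_eqF.
Qed.

Lemma branch_colour_ex (c : T) : exists x : branch, colour (sval x) c.
Proof.
have [y [_ _ h]] := @branch_dense (fun _ _ => false) [::] 0 (fun=> false) [::] c
  (fun _ _ => ltac:(done)) (fun _ => ltac:(done)).
by exists y.
Qed.

Lemma branch_support (x : branch) : exists L, forall n m, sval x n m -> In m L.
Proof. by case: x => x []. Qed.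

Lemma branch_coloured (x : branch) : exists c, colour (sval x) c.
Proof. by case: x => x []. Qed.

(** A branch is determined by its finitely many finite terms before it stabilizes, and by its
    colour. The value [None] is for numbers that decode to no branch. *)
Lemma branch_countable (e : nat -> T) : (forall x, exists n, e n = x) ->
  exists e' : nat -> option branch, forall x, exists n, e' n = Some x.
Proof.
move=> se.
pose dec (l : seq (seq nat) * nat) n m :=
  if n < size l.1 then `[< In m (map e (nth [::] l.1 n)) >] else `[< m = e l.2 >].
exists (fun n => if unpickle n is Some l then
  if pselect (exists x : branch, sval x = dec l) is left h then Some (sval (cid h)) else None
  else None) => x.
suff [l hl] : exists l, sval x = dec l.
  exists (pickle l); rewrite pickleK; case: pselect => [h|]; last by case; exists x.
  by congr Some; case: cid => y /= ey; apply: branch_inj => n m; rewrite ey hl.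
have [L hL] := branch_support x; have [c [k hk]] := branch_coloured x.
have [j ej] := se c.
have fin (f : T -> bool) M : (forall m, f m -> In m M) ->
    exists l, forall m, f m = `[< In m (map e l) >].
  elim: M f => [|a M IH] f hf.
    by exists [::] => m; case fm : (f m); [case: (hf m fm)|rewrite asboolF].
  have [m|l hl] := IH (fun m => f m && ~~ `[< m = a >]).
    by move=> /andP[/hf[->|//]]; rewrite asboolT.
  case fa : (f a).
    have [i ei] := se a; exists (i :: l) => m; have := hl m.
    rewrite /= ei; case: (asboolP (m = a)) => [->|ne].
      by move=> _; rewrite fa asboolT //; left.
    rewrite andbT => ->; apply/idP/idP => /asboolP h; apply/asboolP; first by right.
    by case: h => // e'; case: ne.
  exists l => m; rewrite -hl; case: (asboolP (m = a)) => [->|]; rewrite ?andbT //; by rewrite fa.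
have /choice[g hg] : forall n, exists l, forall m, sval x n m = `[< In m (map e l) >].
  by move=> n; apply: fin (hL n).
exists (mkseq g k, j); apply: funext => n; apply: funext => m.
rewrite /dec /= size_mkseq; case: ltnP => h; first by rewrite nth_mkseq.
by rewrite hk // ej.
Qed.

End Branch.

(** * Matching the splitting of two pairs of branches *)

Section Match.
Variables (X Y : Type).
Implicit Types (s : seq (X * Y)).

(** As long as [x] and [y] agree, so do their partners, and the next differences correspond through
    [s]. The whole difference is required to lie in the finite list [s], which makes the condition
    stable under extending [s] and yields the converse for agreement. *)
Definition bmatch s (x y : nat -> X -> bool) (x' y' : nat -> Y -> bool) :=
  forall i, agree i x y -> [/\ agree i x' y',
  forall m, x i m (+) y i m -> exists2 m', In (m, m') s & x' i m' (+) y' i m' &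
  forall m', x' i m' (+) y' i m' -> exists2 m, In (m, m') s & x i m (+) y i m].

(** By induction on the level: a first disagreement of [x] and [y] would be carried by [s] to one of
    [x'] and [y']. *)
Lemma bmatch_agree s x y x' y' i : bmatch s x y x' y' -> agree i x' y' -> agree i x y.
Proof.
move=> h; elim: i => // i IH /agreeS[/IH a e]; apply/agreeS; split=> // m.
have [_ + _] := h i a; move=> /(_ m); case: (x i m); case: (y i m) => //= /(_ isT)[m' _];
  by rewrite e addbb.
Qed.

Lemma bmatch_incl s s' x y x' y' : List.incl s s' -> bmatch s x y x' y' -> bmatch s' x y x' y'.
Proof.
move=> ss' h i /h[a b c]; split=> // m; first by move=> /b[m' /ss']; exists m'.
by move=> /c[m' /ss']; exists m'.
Qed.

Lemma bmatch_flip s x y x' y' : bmatch s x y x' y' -> bmatch s y x y' x'.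
Proof.
move=> h i /agree_sym/h[a b c]; split=> [|m|m]; first exact: agree_sym.
  by rewrite addbC => /b[m']; exists m' => //; rewrite addbC.
by rewrite addbC => /c[m']; exists m' => //; rewrite addbC.
Qed.

Lemma bmatch_refl s x x' : bmatch s x x x' x'.
Proof. by move=> i _; split=> // m; rewrite addbb. Qed.

End Match.

Lemma bmatch_sym X Y (s : seq (X * Y)) x y x' y' :
  bmatch s x y x' y' -> bmatch (map (@swap X Y) s) x' y' x y.
Proof.
move=> h i a; have a' := bmatch_agree h a; have [_ b c] := h i a'; split=> // m.
  by move=> /c[m' hm]; exists m' => //; apply/In_swap.
by move=> /b[m' hm]; exists m' => //; apply/In_swap.
Qed.

Section MatchExtension.
Variables (R : Type) (ar : R -> nat) (X Y : Type) (RX : interp ar X) (RY : interp ar Y).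
Variables (I : seq (X * Y) -> Prop) (PI : piso RX RY I) (s : seq (X * Y)) (Is : I s).

Lemma bmatch_eq x y x' y' i m m' : bmatch s x y x' y' -> agree i x y -> In (m, m') s ->
  x i m (+) y i m = x' i m' (+) y' i m'.
Proof.
move=> h a hm; have [_ b c] := h i a; apply/idP/idP => [/b[n hn]|/c[n hn]].
  by rewrite -(proj1 (piso_eq PI Is hm hn) erefl).
by rewrite -(proj2 (piso_eq PI Is hm hn) erefl).
Qed.

(* The type of a new branch over finitely many old ones is given by its splitting
   with a closest old branch. *)
Lemma bmatch_extend x y z x' y' z' i (f : X -> bool) (f' : Y -> bool) :
  bmatch s x y x' y' ->
  agree i z x -> agree i z' x' -> (forall m, z i m = x i m (+) f m) ->
  (forall m, z' i m = x' i m (+) f' m) ->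
  (forall m, f m -> exists2 m', In (m, m') s & f' m') ->
  (forall m', f' m' -> exists2 m, In (m, m') s & f m) ->
  ~ agree i.+1 z y -> bmatch s z y z' y'.
Proof.
move=> h zx zx' ez ez' hf hf' na j zy.
have fE m m' : In (m, m') s -> f m = f' m'.
  move=> hm; apply/idP/idP => [/hf[n hn]|/hf'[n hn]].
    by rewrite -(proj1 (piso_eq PI Is hm hn) erefl).
  by rewrite -(proj2 (piso_eq PI Is hm hn) erefl).
have ji : j <= i by rewrite leqNgt; apply/negP => lt; apply: na; apply: agree_le zy.
have xy : agree j x y by apply: agree_trans zy; apply: agree_sym; apply: agree_le zx.
have [xy' b c] := h j xy.
have zy' : agree j z' y' by apply: agree_trans xy'; apply: agree_le zx'.
split=> // m; move: ji; rewrite leq_eqVlt => /orP[/eqP ji|ji].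
- rewrite ji ez addbAC => hm.
  suff [m' hm'] : exists m', In (m, m') s.
    exists m' => //; rewrite ez' addbAC -(fE _ _ hm') -ji.
    by rewrite -(bmatch_eq h xy hm') ji.
  case fm : (f m) hm; first by have [m' ? _] := hf m fm; exists m'.
  by rewrite addbF -ji => /b[m' ? _]; exists m'.
- by rewrite zx // zx' //; apply: b.
- rewrite ji ez' addbAC => hm.
  suff [m' hm'] : exists m', In (m', m) s.
    exists m' => //; rewrite ez addbAC (fE _ _ hm') -ji.
    by rewrite (bmatch_eq h xy hm') ji.
  case fm : (f' m) hm; first by have [m' ? _] := hf' m fm; exists m'.
  by rewrite addbF -ji => /c[m' ? _]; exists m'.
- by rewrite zx // zx' //; apply: c.
Qed.

End MatchExtension.

(** * The expansion of a structure *)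

Section Expansion.
Variable S : signature.

(** The new language is purely relational: function symbols of the base enter through their graphs,
    as they have no natural values outside the base. *)
Inductive xrel :=
  | XBase of atom S | XU | XP | XColour | XAgree of nat | XDiff of nat.

Definition xrel_arity (r : xrel) : nat :=
  match r with
  | XBase r => atom_arity r | XU | XP => 1 | XColour | XAgree _ => 2 | XDiff _ => 3
  end.

Lemma xrel_countable : card_le xrel nat.
Proof.
have [c hc] := atom_countable S.
pose g (r : xrel) : nat + bool * bool + nat + nat := match r with
  | XBase r => inl (inl (inl (c r))) | XU => inl (inl (inr (true, true)))
  | XP => inl (inl (inr (true, false))) | XColour => inl (inl (inr (false, false)))
  | XAgree n => inl (inr n) | XDiff n => inr n end.
exists (fun r => pickle (g r)) => x y /(pcan_inj pickleK).
by case: x y => [r||||n|n] [r'||||n'|n'] //= [] => [/hc->|->|->].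
Qed.

Lemma void_countable : card_le void nat.
Proof. by exists (fun v : void => match v with end) => -[]. Qed.

Definition xsig : signature :=
  @Signature void xrel (fun=> 0) xrel_arity void_countable xrel_countable.

(* The base, the homogeneous predicate (a bare copy of the base) and the branches. *)
Inductive point (T : Type) := Ub of T | Pt of T | Br of branch T.

Section Structure.
Variable M : structure S.
Local Notation point := (point (dom M)).

Definition in_U (p : point) := if p is Ub _ then True else False.
Definition in_P (p : point) := if p is Pt _ then True else False.
Definition pt_colour (p p' : point) :=
  match p, p' with Br x, Pt c => colour (sval x) c | _, _ => False end.
Definition pt_agree n (p p' : point) :=
  match p, p' with Br x, Br y => agree n (sval x) (sval y) | _, _ => False end.
Definition pt_diff n (p p' u : point) :=
  match p, p', u with
  | Br x, Br y, Ub m => agree n (sval x) (sval y) /\ sval x n m (+) sval y n m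
  | _, _, _ => False end.
Definition pt_base (r : atom S) (a : 'I_(atom_arity r) -> point) :=
  exists2 m, (forall i, a i = Ub (m i)) & @holds S M r m.

Definition xrels (r : xrel) : ('I_(xrel_arity r) -> point) -> Prop :=
  match r return ('I_(xrel_arity r) -> point) -> Prop with
  | XBase r => @pt_base r
  | XU => fun a => in_U (a ord0)
  | XP => fun a => in_P (a ord0)
  | XColour => fun a => pt_colour (a ord0) (a ord_max)
  | XAgree n => fun a => pt_agree n (a ord0) (a ord_max)
  | XDiff n => fun a => pt_diff n (a ord0) (a (lift ord0 ord0)) (a ord_max)
  end.

Definition expansion : structure xsig :=
  @Structure xsig point (Ub (dom_inh M)) (fun f => match f with end) xrels.

End Structure.

(** * Lifting back-and-forth systems to the expansion *)

Section Core.
Variables (M N : structure S) (I0 : seq (dom M * dom N) -> Prop).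
Variables (R : Type) (ar : R -> nat) (RM : interp ar (dom M)) (RN : interp ar (dom N)).
Variable (I1 : seq (dom M * dom N) -> Prop).

(** [s0] matches the base, [s1] the predicate P and the colours. Keeping them independent is what
    allows P to be permuted while the base is fixed. *)
Definition pair_ok (s0 s1 : seq (dom M * dom N)) (p : point (dom M)) (p' : point (dom N)) :=
  match p, p' with
  | Ub m, Ub m' => In (m, m') s0
  | Pt m, Pt m' => In (m, m') s1
  | Br x, Br x' => exists c c', [/\ colour (sval x) c, colour (sval x') c' & In (c, c') s1]
  | _, _ => False
  end.

(** [s0] and [s1] may contain more than the points named in [s]: they also carry the finite
    differences of the branches and their colours. *)
Definition lifted (s : seq (point (dom M) * point (dom N))) := exists s0 s1, [/\ I0 s0, I1 s1,
  forall p p', In (p, p') s -> pair_ok s0 s1 p p' &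
  forall x y x' y', In (Br x, Br x') s -> In (Br y, Br y') s ->
    bmatch s0 (sval x) (sval y) (sval x') (sval y')].

Hypotheses (P0 : piso_struct I0) (P1 : piso RM RN I1).

Lemma pair_ok_incl s0 s1 s0' s1' p p' :
  List.incl s0 s0' -> List.incl s1 s1' -> pair_ok s0 s1 p p' -> pair_ok s0' s1' p p'.
Proof.
move=> i0 i1; case: p p' => [m|m|x] [m'|m'|x'] //=; [exact: i0|exact: i1|].
by move=> [c [c' [h h' /i1]]]; exists c, c'.
Qed.

Lemma lifted_eq s p p' r r' : lifted s -> In (p, p') s -> In (r, r') s -> p = r <-> p' = r'.
Proof.
move=> [s0 [s1 [Is0 Is1 ok hb]]] hp hr.
have := ok _ _ hp; have := ok _ _ hr.
case: p p' r r' hp hr => [m|m|x] [m'|m'|x'] [n|n|y] [n'|n'|y'] //= hp hr h h'.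
- by split=> -[e]; congr Ub; apply/(piso_eq P0 Is0 h' h).
- by split=> -[e]; congr Pt; apply/(piso_eq P1 Is1 h' h).
- have bm := hb _ _ _ _ hp hr; split=> -[e]; congr Br; apply: branch_agree => i.
    by subst y; have [] := bm i (fun _ _ => erefl).
  by subst y'; apply: (bmatch_agree bm).
Qed.

(** A new branch leaves each of the finitely many listed ones at some level. Take the least [i] such
    that all have been left by level [i.+1]; by minimality some [z] is still followed below [i], and
    for [i = 0] any listed branch will do. *)
Lemma fresh_split (x : branch (dom M)) (s : seq (point (dom M) * point (dom N))) y y' :
  In (Br y, Br y') s -> (forall y', ~ In (Br x, Br y') s) ->
  exists i z z', [/\ In (Br z, Br z') s, agree i (sval x) (sval z) &
    forall w w', In (Br w, Br w') s -> ~ agree i.+1 (sval x) (sval w)].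
Proof.
move=> hy hx.
have [k hk] : exists k, forall w w', In (Br w, Br w') s -> ~ agree k (sval x) (sval w).
  elim: s hx {hy} => [|[p p'] s IH] hx; first by exists 0.
  have [|k hk] := IH; first by move=> z h; apply: (hx z); right.
  have [[w ew]|no] := EM (exists w, p = Br w); last first.
    exists k => w w' [[e _]|]; last exact: hk.
    by case: no; exists w.
  have [l hl] : exists l, p' = p' /\ (forall w', p' = Br w' -> ~ agree l (sval x) (sval w)).
    have [e|ne] := EM (forall i, agree i (sval x) (sval w)).
      have ex := branch_agree e; exists 0; split=> // w' ep; case: (hx w').
      by left; rewrite ew ep ex.
    have /existsNP[l nl] := ne; by exists l.
  exists (maxn k l) => v v' [[e1 e2]|hv] a.
    have evw : w = v by move: ew; rewrite e1 => -[].
    subst v; case: hl => _ /(_ _ e2); apply; apply: agree_le a; exact: leq_maxr.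
  by apply: (hk _ _ hv); apply: agree_le a; exact: leq_maxl.
have : exists i, `[< forall w w', In (Br w, Br w') s -> ~ agree i.+1 (sval x) (sval w) >].
  exists k; apply/asboolP => w w' hw a; apply: (hk _ _ hw); exact: agree_le a.
move=> /ex_minnP[i /asboolP hi mini]; case: i hi mini => [|i] hi mini.
  by exists 0, y, y'; split.
have : ~ (forall w w', In (Br w, Br w') s -> ~ agree i.+1 (sval x) (sval w)).
  by move=> /asboolP/mini; rewrite ltnn.
move=> /existsNP[z /existsNP[z' /not_implyP[hz /contrapT a]]].
by exists i.+1, z, z'.
Qed.

Lemma lifted_forth s p : lifted s -> exists p', lifted ((p, p') :: s).
Proof.
move=> [s0 [s1 [Is0 Is1 ok hb]]]; case: p => [m|m|x].
- have [m' I'] := piso_forth P0 m Is0; exists (Ub m'), ((m, m') :: s0), s1; split=> //.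
    move=> p p' /= [[<- <-]|/ok h]; first by left.
    by apply: pair_ok_incl h => // q; right.
  move=> x y x' y' /= [//|hx] [//|hy]; apply: bmatch_incl (hb _ _ _ _ hx hy) => q; by right.
- have [m' I'] := piso_forth P1 m Is1; exists (Pt m'), s0, ((m, m') :: s1); split=> //.
    move=> p p' /= [[<- <-]|/ok h]; first by left.
    by apply: pair_ok_incl h => // q; right.
  by move=> x y x' y' /= [//|hx] [//|hy]; exact: hb.
have [[x' hx]|fresh] := EM (exists x', In (Br x, Br x') s).
  exists (Br x'), s0, s1; split=> //.
    by move=> p p' /= [[<- <-]|]; apply: ok.
  move=> y z y' z' hy hz; apply: hb.
    by case: hy => // -[<- <-].
  by case: hz => // -[<- <-].
have hx x' : ~ In (Br x, Br x') s by move=> h; apply: fresh; exists x'.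
have [c hc] := branch_coloured x; have [c' Ic] := piso_forth P1 c Is1.
(* With no earlier branch to compare with, only the colour has to be matched. *)
have [[y [y' hy]]|none] := EM (exists y y', In (Br y, Br y') s); last first.
  have [x' hx'] := branch_colour_ex c'; exists (Br x'), s0, ((c, c') :: s1); split=> //.
    move=> p p' /= [[<- <-]|/ok h]; first by exists c, c'; split=> //; left.
    by apply: pair_ok_incl h => // q; right.
  move=> y z y' z' /= [[<- <-]|hy]; last by case: none; exists y, y'.
  move=> [[<- <-]|hz]; last by case: none; exists z, z'.
  exact: bmatch_refl.
(* The difference [f] of [x] from a closest branch [z] is finite, so [s0] extends to a list [s0']
   that carries it to a finite set [f']. The partner [x'] then leaves [z'] at level [i] by [f'] and
   takes the colour [c']. *)
have [i [z [z' [hz az far]]]] := fresh_split hy hx.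
pose f m := sval x i m (+) sval z i m.
have [Lx hLx] := branch_support x; have [Lz hLz] := branch_support z.
have [s0' [Is0' ss0 hs0]] := piso_list (Lx ++ Lz) P0 Is0.
have fL m : f m -> exists m', In (m, m') s0'.
  rewrite /f => h; apply: hs0; apply/List.in_app_iff; move: h.
  case xm : (sval x i m); first by move=> _; left; apply: hLx xm.
  by move=> /= zm; right; apply: hLz zm.
pose f' m' := `[< exists2 m, In (m, m') s0' & f m >].
have [Lz' hLz'] := branch_support z'.
have hf' m' : f' m' -> In m' (map snd s0').
  by move=> /asboolP[m h _]; apply/In_map; exists (m, m').
have [x' [ax ex cx]] := @branch_dense _ (sval z') Lz' i f' _ c' hLz' hf'.
have new w w' : In (Br w, Br w') s -> bmatch s0' (sval x) (sval w) (sval x') (sval w').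
  move=> hw; apply: (bmatch_extend P0 Is0' (f := f) (f' := f')
    (bmatch_incl ss0 (hb _ _ _ _ hz hw)) az ax _ ex).
  - by move=> m; rewrite /f /=; case: (sval x i m); case: (sval z i m).
  - by move=> m fm; have [m' hm] := fL m fm; exists m' => //; apply/asboolP; exists m.
  - by move=> m' /asboolP.
  - exact: far hw.
exists (Br x'), s0', ((c, c') :: s1); split=> //.
  move=> p p' /= [[<- <-]|/ok h]; first by exists c, c'; split=> //; left.
  by apply: pair_ok_incl h => // q; right.
move=> v w v' w' /= [[<- <-]|hv] [[<- <-]|hw].
- exact: bmatch_refl.
- exact: new.
- exact/bmatch_flip/new.
- exact: bmatch_incl (hb _ _ _ _ hv hw).
Qed.

(** One implication is enough: the other is the same statement for the swapped system. *)
Lemma lifted_rel s (r : xrel) (v : 'I_(xrel_arity r) -> point (dom M) * point (dom N)) :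
  lifted s -> (forall i, In (v i) s) ->
  @xrels M r (fun i => (v i).1) -> @xrels N r (fun i => (v i).2).
Proof.
move=> [s0 [s1 [Is0 Is1 ok hb]]] hv.
have hv' i : In ((v i).1, (v i).2) s by case: (v i) (hv i).
have ok' i := ok _ _ (hv' i).
case: r v hv hv' ok' => [r||||n|n] v hv hv' ok' /=.
- move=> [m em hm].
  have /choice[m' em'] : forall i, exists m', (v i).2 = Ub m' /\ In (m i, m') s0.
    by move=> i; have := ok' i; rewrite em; case: (v i).2 => // m' h; exists m'.
  exists m' => [i|]; first by case: (em' i).
  exact: (proj1 (piso_rel P0 (v := fun i => (m i, m' i)) Is0 (fun i => proj2 (em' i))) hm).
- by have := ok' ord0; case: (v ord0).1 => // m; case: (v ord0).2.
- by have := ok' ord0; case: (v ord0).1 => // m; case: (v ord0).2.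
- have := ok' ord0; have := ok' ord_max.
  case: (v ord0).1 => // x; case: (v ord_max).1 => // c; case: (v ord0).2 => // x'.
  case: (v ord_max).2 => // c' /= hc [d [d' [hd hd' hdd]]] hxc.
  have e := colour_uniq hd hxc; subst d.
  by rewrite -(proj1 (piso_eq P1 Is1 hdd hc) erefl).
- have := hv' ord0; have := hv' ord_max; have := ok' ord0; have := ok' ord_max.
  case: (v ord0).1 => // x; case: (v ord_max).1 => // y; case: (v ord0).2 => // x'.
  by case: (v ord_max).2 => // y' /= _ _ hy hx /(hb _ _ _ _ hx hy)[].
- have := hv' ord0; have := hv' (lift ord0 ord0).
  have := ok' ord0; have := ok' (lift ord0 ord0); have := ok' ord_max.
  case: (v ord0).1 => // x; case: (v (lift ord0 ord0)).1 => // y; case: (v ord_max).1 => // u.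
  case: (v ord0).2 => // x'; case: (v (lift ord0 ord0)).2 => // y'; case: (v ord_max).2 => // u'.
  move=> /= hu _ _ hy hx [a d]; have bm := hb _ _ _ _ hx hy.
  by split; [case: (bm _ a)|rewrite -(bmatch_eq P0 Is0 bm a hu)].
Qed.

End Core.

Lemma lifted_sym M N I0 I1 s : @lifted M N I0 I1 s ->
  @lifted N M (fun t => I0 (map (@swap _ _) t)) (fun t => I1 (map (@swap _ _) t))
    (map (@swap _ _) s).
Proof.
move=> [s0 [s1 [Is0 Is1 ok hb]]].
exists (map (@swap _ _) s0), (map (@swap _ _) s1); rewrite !map_swapK; split=> //.
  move=> p p' /In_swap/ok; case: p p' => [m|m|x] [m'|m'|x'] //=; try by move/In_swap.
  by move=> [c [c' [h h' /In_swap]]]; exists c', c.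
by move=> x y x' y' /In_swap hx /In_swap hy; apply: bmatch_sym; apply: hb.
Qed.

Theorem lifted_piso M N I0 R (ar : R -> nat) (RM : interp ar (dom M)) (RN : interp ar (dom N)) I1 :
  @piso_struct S M N I0 -> piso RM RN I1 ->
  @piso_struct xsig (expansion M) (expansion N) (lifted I0 I1).
Proof.
move=> P0 P1.
have unswap s : lifted (fun t => I0 (map (@swap _ _) (map (@swap _ _) t)))
    (fun t => I1 (map (@swap _ _) (map (@swap _ _) t))) s -> lifted I0 I1 s.
  by under eq_fun do rewrite map_swapK; under [X in lifted _ X]eq_fun do rewrite map_swapK.
split.
- by exists [::], [::]; split=> //; [exact: piso_nil P0|exact: piso_nil P1].
- by move=> s p; exact: (lifted_forth P0 P1).
- move=> s p' /lifted_sym h; have [p hp] := lifted_forth (piso_sym P0) (piso_sym P1) p' h.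
  by exists p; move/lifted_sym: hp => /=; rewrite map_swapK => /unswap.
- by move=> s p p' r r'; exact: (lifted_eq P0 P1).
- move=> s [r|[]] v hs hv; split; first exact: (lifted_rel P0 P1 hs).
  have h := lifted_sym hs.
  have := @lifted_rel _ _ _ _ _ _ _ _ (piso_sym P0) (piso_sym P1) _ r (fun i => swap (v i)) h.
  by apply=> i; apply/In_map; exists (v i).
Qed.

End Expansion.

(** * Complete homogeneity of the countable expansion *)

Definition enumerated (X : Type) := exists e : nat -> X, forall x, exists n, e n = x.

Lemma card_eq_nat_enumerated X : card_eq X nat -> enumerated X.
Proof. by move=> [f [g fg gf]]; exists g => x; exists (f x). Qed.

Lemma infinite_fresh X (l : seq X) : infinite_type X -> exists x, ~ In x l.
Proof.
move=> [f fI]; suff [k hk] : exists k, forall n, k <= n -> ~ In (f n) l.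
  by exists (f k); apply: hk.
elim: l => [|a l [k hk]]; first by exists 0 => n _ [].
have [[m em]|no] := EM (exists m, f m = a).
  exists (maxn k m.+1) => n; rewrite geq_max => /andP[kn mn] /= [e|]; last exact: hk kn.
  by move: mn; rewrite (fI m n) ?ltnn // em.
by exists k => n kn /= [e|]; [case: no; exists n|exact: hk kn].
Qed.

Definition no_interp (X : Type) : interp (fun v : void => match v with end) X :=
  fun v => match v with end.
Arguments no_interp : clear implicits.

(** Between infinite pure sets all finite partial injections form a system, since a fresh partner
    always exists. This is used to count infinite enumerated types. *)
Lemma infinite_piso X Y : infinite_type X -> infinite_type Y ->
  piso (no_interp X) (no_interp Y)
    (fun s => forall x y x' y', In (x, y) s -> In (x', y') s -> x = x' <-> y = y').
Proof.
have forth A B (s : seq (A * B)) a : infinite_type B ->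
    (forall x y x' y', In (x, y) s -> In (x', y') s -> x = x' <-> y = y') ->
    exists b, forall x y x' y', In (x, y) ((a, b) :: s) -> In (x', y') ((a, b) :: s) ->
      x = x' <-> y = y'.
  move=> iB hs; have [[b hb]|no] := EM (exists b, In (a, b) s).
    exists b => x y x' y' [[<- <-]|h] [[<- <-]|h'] //; exact: hs.
  have [b hb] := infinite_fresh (map snd s) iB.
  have hb' x : ~ In (x, b) s by move=> h; apply: hb; apply/In_map; exists (x, b).
  exists b => x y x' y' [[<- <-]|h] [[<- <-]|h'] //; last exact: hs.
  - split=> e; [by case: no; exists y'; rewrite e|by case: (hb' x'); rewrite e].
  - split=> e; [by case: no; exists y; rewrite -e|by case: (hb' x); rewrite -e].
move=> iX iY; split=> //.
- by move=> s x; exact: forth.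
- move=> s y hs; have [] := forth _ _ (map (@swap X Y) s) y iX.
    by move=> a b a' b' /In_swap h /In_swap h'; apply: iff_sym; exact: hs.
  move=> x hx; exists x => a b a' b' h h'; apply: iff_sym; apply: hx.
    by case: h => [[-> ->]|h]; [left|right; apply/In_swap].
  by case: h' => [[-> ->]|h']; [left|right; apply/In_swap].
- by move=> s x y x' y' hs; exact: hs.
- by move=> s [].
Qed.

Lemma enumerated_card_eq X : infinite_type X -> enumerated X -> card_eq X nat.
Proof.
move=> iX [e se]; have inat : infinite_type nat by exists id.
have [h [hb _ _]] := piso_countable (infinite_piso iX inat) se (fun n => ex_intro _ n erefl).
by exists h.
Qed.

Section Homogeneity.
Variable S : signature.

Lemma point_enumerated T : enumerated T -> enumerated (point T).
Proof.
move=> [e se]; have [e' se'] := branch_countable se.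
exists (fun n => match @unpickle (nat + nat + nat)%type n with
  | Some (inl (inl i)) => Ub (e i) | Some (inl (inr i)) => Pt (e i)
  | Some (inr i) => if e' i is Some x then Br x else Ub (e i)
  | None => Ub (e 0) end).
case=> [t|t|x].
- by have [i hi] := se t; exists (pickle (inl (inl i) : nat + nat + nat)); rewrite pickleK hi.
- by have [i hi] := se t; exists (pickle (inl (inr i) : nat + nat + nat)); rewrite pickleK hi.
- by have [i hi] := se' x; exists (pickle (inr i : nat + nat + nat)); rewrite pickleK hi.
Qed.

Lemma infinite_point T : infinite_type T -> infinite_type (point T).
Proof. by move=> [f hf]; exists (fun n => Ub (f n)) => m n [] /hf. Qed.

Variables (N : structure S) (eN : enumerated (dom N)).

Lemma identity_piso : @piso_struct S N N (fun s => forall x y, In (x, y) s -> x = y).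
Proof.
split=> //.
- by move=> s x h; exists x => a b /= [[<- <-]|/h].
- by move=> s x h; exists x => a b /= [[<- <-]|/h].
- by move=> s x y x' y' h /h -> /h ->.
- move=> s r v h hv; have -> // : (fun i => (v i).1) = (fun i => (v i).2).
  by apply: funext => i; apply: h; case: (v i) (hv i).
Qed.

Lemma graph_piso X (pi : X -> X) : bijective pi ->
  piso (no_interp X) (no_interp X) (fun s => forall x y, In (x, y) s -> pi x = y).
Proof.
move=> pb; have pI := bij_inj pb; case: pb => pi' piK pi'K; split=> //.
- by move=> s x h; exists (pi x) => a b /= [[<- <-]|/h].
- by move=> s y h; exists (pi' y) => a b /= [[<- <-]|/h].
- by move=> s x y x' y' h /h <- /h <-; split=> [->|/pI].
- by move=> s [].
Qed.

Lemma expansion_extends (pi : dom N -> dom N) : bijective pi ->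
  exists h : point (dom N) -> point (dom N), [/\ bijective h,
    forall r (a : 'I_(xrel_arity r) -> _), @xrels S N r a <-> xrels (fun i => h (a i)) &
    forall m, h (Pt m) = Pt (pi m)].
Proof.
move=> pb; have PI := lifted_piso identity_piso (graph_piso pb).
have [e se] := point_enumerated eN.
have [h [hb hr hs]] := piso_countable PI se se.
exists h; split=> // [r a|m]; first exact: (hr (inl r) a).
have [s [s0 [s1 [_ h1 ok _]]] /ok] := hs (Pt m); by case: (h (Pt m)) => //= m' /h1 ->.
Qed.

(** The system gives an isomorphism [g] from [B] to the expansion of [N]. A permutation of P is
    conjugated by [g], extended to an automorphism there, and conjugated back. *)
Theorem homogeneous_models B I : infinite_type (dom N) -> enumerated (dom B) ->
  @piso_struct (xsig S) B (expansion N) I -> completely_homogeneous B (XP S).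
Proof.
move=> [f fI] [eB seB] PI; have [e se] := point_enumerated eN.
have [g [gb gr _]] := piso_countable PI seB se.
have grel (r : xrel S) (a : 'I_(xrel_arity r) -> dom B) :
  @rels (xsig S) B r a <-> xrels (fun i => g (a i)) by exact: (gr (inl r) a).
have gP (x : dom B) : @pred_interp (xsig S) B (XP S) x <-> in_P (g x).
  exact: (grel (XP S) (fun=> x)).
have gI := bij_inj gb; case: gb => g' gK g'K.
pose T := {x : dom B | @pred_interp (xsig S) B (XP S) x}.
have psiP m : @pred_interp (xsig S) B (XP S) (g' (Pt m)) by apply/gP; rewrite g'K.
pose psi m : T := exist _ _ (psiP m).
have /choice[phi hphi] : forall t : T, exists m, g (sval t) = Pt m.
  by case=> x /= /gP; case: (g x) => // m _; exists m.
have psiK : cancel psi phi by move=> m; have := hphi (psi m); rewrite /= g'K => -[].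
have phiK : cancel phi psi.
  case=> x px; apply: eq_exist; by rewrite /= -(hphi (exist _ x px)) /= gK.
split; first by exists (fun n => psi (f n)) => m n /(can_inj psiK)/fI.
move=> pi pb; have pb' : bijective (fun m => phi (pi (psi m))).
  by apply: bij_comp (Bijective phiK psiK) _; apply: bij_comp pb (Bijective psiK phiK).
have [h [hb hr hP]] := expansion_extends pb'.
exists (fun x => g' (h (g x))); split.
  split; first by apply: bij_comp (Bijective g'K gK) _; apply: bij_comp hb (Bijective gK g'K).
  split=> [[]|r a]; rewrite (grel r) (grel r) (hr r).
  by have -> : (fun i => g (g' (h (g (a i))))) = (fun i => h (g (a i))) by apply: funext => i.
by move=> t; apply: gI; rewrite (hphi t) g'K hP phiK -hphi.
Qed.

End Homogeneity.

(** * Closed subsets of successor cardinality *)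

(** Turns a well-ordering given by least elements of nonempty sets into a strict well-founded
    relation, as recursion requires. *)
Lemma well_ordering X : exists lt : X -> X -> Prop,
  [/\ well_founded lt, forall x y z, lt x y -> lt y z -> lt x z &
      forall x y, [\/ lt x y, x = y | lt y x]].
Proof.
have [R wo] := wochoice.well_ordering_principle {classic X}.
have least (P : X -> Prop) : (exists x, P x) ->
    exists2 z, P z & forall x, P x -> R z x.
  move=> [x px]; have [|z [[zP zmin] _]] := wo [pred x | `[< P x >]].
    by exists x; rewrite inE; apply/asboolP.
  exists z => [|y py]; first by move: zP; rewrite inE => /asboolP.
  by apply: zmin; rewrite inE; apply/asboolP.
have tot x y : R x y \/ R y x.
  have [z [->|->] h] := least (fun z => z = x \/ z = y) (ex_intro _ x (or_introl erefl)).
    by left; apply: h; right.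
  by right; apply: h; left.
have refl x : R x x by case: (tot x x).
(* Antisymmetry comes from the uniqueness of the least element of the set of [x] and [y];
   transitivity below comes from a least element among three. *)
have anti x y : R x y -> R y x -> x = y.
  move=> xy yx; have [|z [_ u]] := wo [pred z | (z == x) || (z == y)].
    by exists x; rewrite inE eqxx.
  have h w : w = x \/ w = y -> z = w.
    move=> hw; apply: u; split; first by rewrite inE; case: hw => ->; rewrite eqxx ?orbT.
    by move=> v; rewrite inE => /orP[]/eqP->; case: hw => ->.
  by rewrite -(h x) ?(h y) //; [right|left].
have trans x y z : R x y -> R y z -> R x z.
  move=> xy yz; have [|w hw h] := least (fun w => [\/ w = x, w = y | w = z]).
    by exists x; apply: Or31.
  case: hw => e; subst w; first by apply: h; apply: Or33.
    by rewrite (anti x y) //; apply: h; apply: Or31.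
  by rewrite -(anti y z) //; apply: h; apply: Or32.
exists (fun x y => R x y /\ x <> y); split.
- move=> x; apply: contrapT => nx.
  have [z nz hz] := least (fun x => ~ Acc (fun x y => R x y /\ x <> y) x) (ex_intro _ x nx).
  apply: nz; split=> y [yz ne]; apply: contrapT => ny; apply: ne; apply: anti => //; exact: hz.
- move=> x y z [xy nxy] [yz nyz]; split; first exact: trans yz.
  by move=> e; subst z; apply: nxy; apply: anti.
- move=> x y; have [|ne] := EM (x = y); first exact: Or32.
  by have [h|h] := tot x y; [apply: Or31|apply: Or33; split=> // /esym].
Qed.

(* An injection is built by well-founded recursion, each value avoiding the previous
   ones. *)
Lemma wf_injection H X (lt : H -> H -> Prop) (x0 : X) : well_founded lt ->
  (forall x y, [\/ lt x y, x = y | lt y x]) ->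
  (forall h (phi : H -> X), exists x, forall h', lt h' h -> phi h' <> x) -> card_le H X.
Proof.
move=> wf tri ext.
have ext' h (rec : forall h', lt h' h -> X) : exists x, forall h' (p : lt h' h), rec h' p <> x.
  have [x hx] := ext h (fun h' => if pselect (lt h' h) is left p then rec h' p else x0).
  exists x => h' p; have := hx h' p; case: pselect => // p'.
  by rewrite (Prop_irrelevance p' p).
pose F h rec : X := sval (cid (ext' h rec)).
pose f := Fix wf (fun=> X) F.
have fE h : f h = F h (fun h' _ => f h').
  apply: Fix_eq => {}h g g' e; congr F.
  by apply: functional_extensionality_dep => h'; apply: functional_extensionality_dep => p.
have fne h' h : lt h' h -> f h' <> f h.
  by move=> p; rewrite (fE h) /F; case: cid => x /= /(_ h' p).
exists f => h h' e; case: (tri h h') => // p; first by case: (fne _ _ p).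
by case: (fne _ _ p).
Qed.

(** * Closure under witnesses and the successor of [K] *)

Section Hull.
Variables (K : Type) (iK : infinite_type K) (seqK : card_le (seq K) K).

(** Covering by a family indexed by [K] is easier to combine and iterate than an injection into [K],
    which [small_card_le] extracts at the end. *)
Definition small X (D : X -> Prop) := exists g : K -> X, forall x, D x -> exists k, g k = x.

Lemma surjection_of_injection X Y : card_le X Y -> X ->
  exists f : Y -> X, forall x, exists k, f k = x.
Proof.
move=> [f fI] x0.
exists (fun y => if pselect (exists x, f x = y) is left h then sval (cid h) else x0).
move=> x; exists (f x); case: pselect => [h|[]]; last by exists x.
by case: cid => x' /= /fI.
Qed.

Lemma small_card_le X (D : X -> Prop) : small D -> card_le {x | D x} K.
Proof.
move=> [g hg]; have /choice[f hf] : forall t : {x | D x}, exists k, g k = sval t by case=> x /= /hg.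
exists f => -[x px] [y py] e; apply: eq_exist.
by have := hf (exist _ x px); rewrite e hf => /= ->.
Qed.

Lemma decode_seq : exists d : K -> seq K, forall l, exists k, d k = l.
Proof. exact: surjection_of_injection seqK [::]. Qed.

Lemma decode_nat : exists d : K -> nat, forall n, exists k, d k = n.
Proof. exact: surjection_of_injection iK 0. Qed.

Lemma small_cons X (D : X -> Prop) x : small D -> small (fun y => D y \/ y = x).
Proof.
move=> [g hg]; have [d hd] := decode_seq.
exists (fun k => if d k is a :: _ then g a else x) => y [/hg[k <-]|->].
  by have [k' e] := hd [:: k]; exists k'; rewrite e.
by have [k' e] := hd [::]; exists k'; rewrite e.
Qed.

Variables (X N : Type) (e : nat -> N) (se : forall y, exists n, e n = y).
Variable c : seq (X * N) -> nat -> X.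

(** In the application [c s j] is a witness of the back property: its pair with the element numbered
    [j] of the countable side extends [s]. *)
Inductive hull (A : X -> Prop) : X -> Prop :=
  | hull_base x : A x -> hull A x
  | hull_wit s j : (forall p, In p s -> hull A p.1) -> hull A (c s j).

Lemma hull_mono (A B : X -> Prop) : (forall x, A x -> B x) -> forall x, hull A x -> hull B x.
Proof.
move=> AB; fix IH 2 => x [y /AB h|s j h]; first exact: hull_base.
by apply: hull_wit => p /h; apply: IH.
Qed.

(** Each stage of the closure is again indexed by [K], because [K] codes finite sequences of its
    elements; the countable union of the stages is indexed by pairs of a stage and an index. *)
Lemma hull_small A : small A -> small (hull A).
Proof.
move=> [g hg]; have [d hd] := decode_seq; have [dn hdn] := decode_nat.
(* [F h] covers the range of [h] and all witnesses for lists over it: an index codes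
   either an old index, or [j] followed by a padding and the codes of the pairs. *)
pose F (h : K -> X) k := match d k with
  | [:: a] => h a
  | j :: _ :: l =>
      c (map (fun p => if d p is [:: a; b] then (h a, e (dn b)) else (h j, e 0)) l) (dn j)
  | [::] => g k
  end.
have F1 h k : exists k', F h k' = h k.
  by have [k' ek] := hd [:: k]; exists k'; rewrite /F ek.
have F2 h s j : (forall p, In p s -> exists k, h k = p.1) -> exists k, F h k = c s j.
  move=> hs; have [kj ej] := hdn j.
  have [l el] : exists l, forall kj,
      map (fun p => if d p is [:: a; b] then (h a, e (dn b)) else (h kj, e 0)) l = s.
    elim: s hs => [|[x y] s IH] hs; first by exists [::].
    have [|l hl] := IH; first by move=> p ps; apply: hs; right.
    have [k hk] := hs (x, y) (or_introl erefl); have [n en] := se y; have [b eb] := hdn n.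
    have [k' ek'] := hd [:: k; b]; exists (k' :: l) => kj'.
    by rewrite /= ek' hk eb en hl.
  (* The second [kj] is the padding: even for empty [l] the code differs from the one-element code
     of an old index. *)
  by have [k ek] := hd [:: kj, kj & l]; exists k; rewrite /F ek el ej.
have iterS n m k : n <= m -> exists k', iter m F g k' = iter n F g k.
  move=> nm; rewrite -(subnK nm); elim: (m - n) => [|i [k' ek]]; first by exists k.
  by rewrite addSn /= -ek; exact: F1.
have cover x : hull A x -> exists n k, iter n F g k = x.
  move: x; fix IH 2 => x [y /hg[k <-]|s j hs]; first by exists 0, k.
  suff [n hn] : exists n, forall p, In p s -> exists k, iter n F g k = p.1.
    by have [k hk] := F2 _ s j hn; exists n.+1, k.
  have hs' p : In p s -> exists n k, iter n F g k = p.1 by move=> /hs; apply: IH.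
  elim: {j} s {hs} hs' => [|p s IHs] hs; first by exists 0.
  have [|n hn] := IHs; first by move=> q qs; apply: hs; right.
  have [m [k hm]] := hs p (or_introl erefl).
  exists (maxn n m) => q /= [<-|/hn[k' <-]].
    by rewrite -hm; apply: iterS; exact: leq_maxr.
  by apply: iterS; exact: leq_maxl.
exists (fun k => if d k is [:: a; b] then iter (dn a) F g b else g k) => x /cover[n [b <-]].
by have [a ea] := hdn n; have [k ek] := hd [:: a; b]; exists k; rewrite ek ea.
Qed.

(* The hulls of the small initial segments of a well-ordering of [X] form a chain
   whose union has cardinality the successor of [K]. *)
Theorem successor_hull : ~ card_le X K -> exists D : X -> Prop,
  is_succ_card K {x | D x} /\ forall s j, (forall p, In p s -> D p.1) -> D (c s j).
Proof.
move=> nXK; have [lt [wf trans tri]] := well_ordering X.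
pose seg y z := lt z y \/ z = y.
pose Y y := small (fun z => lt z y).
have smallS (A B : X -> Prop) : (forall x, A x -> B x) -> small B -> small A.
  by move=> AB [g hg]; exists g => x /AB/hg.
(* If [Y] were small, it could not be all of [X]. The least [b'] outside [Y] would have all its
   predecessors in [Y], hence a small segment, and so would belong to [Y]. *)
have nY : ~ small Y.
  move=> sY; have [allY|/existsNP[b nb]] := EM (forall y, Y y).
    apply: nXK; have [f fI] := small_card_le sY.
    by exists (fun x => f (exist _ x (allY x))) => x y /fI[].
  have [b' nb' hb'] : exists2 b, ~ Y b & forall z, lt z b -> Y z.
    elim/(well_founded_ind wf): b nb => b IH nb.
    have [h|/existsNP[z /not_implyP[zb nz]]] := EM (forall z, lt z b -> Y z); first by exists b.
    exact: IH zb nz.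
  by apply: nb'; apply: smallS sY.
have segmono y y' : lt y y' \/ y = y' -> forall x, seg y x -> seg y' x.
  by move=> [yy'|->] // x [xy|->]; left=> //; apply: trans xy yy'.
pose D x := exists2 y, Y y & hull (seg y) x.
have YD y : Y y -> D y by move=> hy; exists y => //; apply: hull_base; right.
have nD : ~ small D by move=> sD; apply: nY; apply: smallS sD.
have [y0 Yy0] : exists y, Y y.
  apply: contrapT => no; apply: nY; have [f fI] := iK.
  have [x0|noX] := EM (inhabited X); last first.
    by case: nXK; exists (fun x => f 0) => x; case: noX.
  by case: x0 => x0; exists (fun=> x0) => y hy; case: no; exists y.
have smallseg y : Y y -> small (hull (seg y)) by move=> hy; apply: hull_small; exact: small_cons.
have closed s j : (forall p, In p s -> D p.1) -> D (c s j).
  move=> hs; suff [y Yy hy] : exists2 y, Y y & forall p, In p s -> hull (seg y) p.1.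
    by exists y => //; apply: hull_wit.
  elim: {j} s hs => [|p s IH] hs; first by exists y0.
  have [|y Yy hy] := IH; first by move=> q qs; apply: hs; right.
  have [z Yz hz] := hs p (or_introl erefl).
  have [zy|] : (lt z y \/ z = y) \/ lt y z by case: (tri z y); [left; left|left; right|right].
    by exists y => // q /= [<-|/hy //]; apply: hull_mono (segmono _ _ zy) _ hz.
  move=> yz; exists z => // q /= [<-//|/hy]; apply: hull_mono; apply: segmono; by left.
exists D; split=> //; pose H := {x | D x}.
have hD : H := exist _ y0 (YD _ Yy0).
have notsmall (g : K -> H) : exists x : H, forall k, g k <> x.
  apply: contrapT => no; apply: nD; exists (fun k => sval (g k)) => x Dx.
  apply: contrapT => nk; apply: no; exists (exist _ x Dx) => k ek; apply: nk.
  by exists k; rewrite ek.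
have KH : card_lt K H.
  split; last first.
    move=> [f fI]; have [g gs] := surjection_of_injection (ex_intro _ f fI) hD.
    by have [x hx] := notsmall g; have [k] := gs x; exact: hx.
  have [ltK [wfK _ triK]] := well_ordering K.
  apply: (wf_injection hD wfK triK) => k phi.
  by have [x hx] := notsmall phi; exists x => k' _.
split=> // Z [[i iI] nZK].
have /choice[r hr] : forall h : H, exists y, Y y /\ hull (seg y) (sval h).
  by case=> x [y Yy hy]; exists y.
(* Lexicographic order: first by the chosen index [r h] of a hull containing [h], then by the point.
   The predecessors of [h] lie in the small hull of [seg (r h)], so their images never exhaust
   [Z]. *)
pose ltH (h h' : H) := lt (r h) (r h') \/ r h = r h' /\ lt (sval h) (sval h').
have wfH : well_founded ltH.
  move=> h; have [y ey] : exists y, r h = y by exists (r h).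
  elim/(well_founded_ind wf): y h ey => y IHy h.
  have [x ex] : exists x, sval h = x by exists (sval h).
  elim/(well_founded_ind wf): x h ex => x IHx h ex ey; split=> h' [l|[rr l]].
    by apply: IHy (erefl (r h')); rewrite -ey.
  by apply: IHx (erefl (sval h')) _; rewrite -?ex // rr.
have triH h h' : [\/ ltH h h', h = h' | ltH h' h].
  case: (tri (r h) (r h')) => [l|rr|l]; [by apply: Or31; left| |by apply: Or33; left].
  case: (tri (sval h) (sval h')) => [l|vv|l].
  - by apply: Or31; right.
  - by apply: Or32; case: h h' vv {rr} => x px [x' px'] /= vv; apply: eq_exist.
  - by apply: Or33; right.
have [f0 _] := iK; pose z0 := i (f0 0).
apply: (wf_injection z0 wfH triH) => h phi.
have [Yh _] := hr h; have [g hg] := smallseg _ Yh.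
pose gZ k := phi (if pselect (D (g k)) is left p then exist _ (g k) p else hD).
apply: contrapT => no; apply: nZK.
have sZ : small (fun _ : Z => True).
  exists gZ => z _; apply: contrapT => nz; apply: no; exists z => h' l eh; apply: nz.
  have [Yh' hh'] := hr h'.
  have [k ek] : exists k, g k = sval h'.
    by apply: hg; apply: hull_mono (segmono _ _ _) _ hh'; case: l => [|[]]; [left|right].
  exists k; rewrite /gZ -eh; congr phi; rewrite ek.
  case: pselect => [p|[]]; last exact: svalP h'.
  by move: p; case: (h') => x px p; apply: eq_exist.
have [f fI] := small_card_le sZ.
by exists (fun z => f (exist _ z I)) => x y /fI[].
Qed.

End Hull.

(** * Cardinality of the models of the Scott sentence *)

Section Bound.
Variables (S : signature) (N : structure S) (K : Type).
Hypotheses (iK : infinite_type K) (powK : card_le (nat -> K) K).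

Lemma card_le_seq_fun : exists g : seq K -> nat -> K, injective g.
Proof.
have [i iI] := iK; exists (fun l n => if n is n'.+1 then nth (i 0) l n' else i (size l)).
move=> l l' e; have sl : size l = size l' by apply: iI; have := congr1 (fun h => h 0) e.
by apply: (@eq_from_nth _ (i 0) _ _ sl) => n _; have := congr1 (fun h => h n.+1) e.
Qed.

Lemma card_le_seq : card_le (seq K) K.
Proof.
by have [f fI] := powK; have [g gI] := card_le_seq_fun; exists (f \o g); apply: inj_comp.
Qed.

(** That the graph relations are total and single-valued transfers from [N] along the system, so
    they define the functions of a structure. *)
Lemma structure_of_piso X (RX : interp (@atom_arity S) X) I (x0 : X) :
  piso RX (@holds S N) I ->
  exists (A : structure S) (J : seq (dom A * dom N) -> Prop), card_eq (dom A) X /\ piso_struct J.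
Proof.
move=> PI.
have ex f (x : 'I_(farity f) -> X) : exists c, forall c', RX (inr f) (graph_arg c' x) <-> c = c'.
  have [s [y [Is _ hy]]] := piso_tuple x PI (piso_nil PI).
  have [c Ic] := piso_back PI (funs y) Is; exists c => c'.
  have [d Id] := piso_forth PI c' Ic.
  have hy' i : In (x i, y i) ((c', d) :: (c, funs y) :: s) by right; right.
  rewrite (piso_graph PI Id hy' (or_introl erefl)).
  by apply: iff_sym; apply: (piso_eq PI Id); [right; left|left].
pose F f x := sval (cid (ex f x)).
pose A := @Structure S X x0 F (fun r => RX (inl r)).
exists A, I; split; first by exists id; exists id.
suff h r a : RX r a <-> @holds S A r a.
  case: PI => n b f e r; split=> // s q v Is hv; exact: iff_trans (iff_sym (h q _)) (r s q v Is hv).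
case: r a => [r|f] a //=.
have -> : a = graph_arg (a ord0) (fun i => a (lift ord0 i)).
  by apply: funext => j; rewrite /graph_arg; case: unliftP => [i ->|->].
rewrite graph_arg0.
have -> : (fun i => graph_arg (a ord0) (fun i => a (lift ord0 i)) (lift ord0 i)) =
    (fun i => a (lift ord0 i)) by apply: funext => i; rewrite graph_argS.
by rewrite /F; case: cid.
Qed.

Variables (B : structure (xsig S)) (I : seq (dom B * point (dom N)) -> Prop).
Hypothesis PI : @piso_struct (xsig S) B (expansion N) I.

(** * Base, colours and branches in a structure equivalent to the expansion *)

Definition pair2 X (x y : X) (i : 'I_2) : X := if i == ord0 then x else y.
Definition pair3 X (x y z : X) (i : 'I_3) : X :=
  if i == ord0 then x else if i == ord_max then z else y.

Definition is_U (x : dom B) := @rels (xsig S) B (XU S) (fun=> x).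
Definition is_P (x : dom B) := @rels (xsig S) B (XP S) (fun=> x).
Definition is_colour (x y : dom B) := @rels (xsig S) B (XColour S) (pair2 x y).
Definition is_agree n (x y : dom B) := @rels (xsig S) B (XAgree S n) (pair2 x y).
Definition is_diff n (x y z : dom B) := @rels (xsig S) B (XDiff S n) (pair3 x y z).

Lemma is_U_piso s x a : I s -> In (x, a) s -> is_U x <-> in_U a.
Proof. by move=> Is h; exact: (piso_rel PI (r := inl (XU S)) (v := fun=> (x, a)) Is). Qed.

Lemma is_P_piso s x a : I s -> In (x, a) s -> is_P x <-> in_P a.
Proof. by move=> Is h; exact: (piso_rel PI (r := inl (XP S)) (v := fun=> (x, a)) Is). Qed.

Lemma pair2E X Y (f : X -> Y) x y : (fun i => f (pair2 x y i)) = pair2 (f x) (f y).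
Proof. by apply: funext => i; rewrite /pair2; case: ifP. Qed.

Lemma pair3E X Y (f : X -> Y) x y z : (fun i => f (pair3 x y z i)) = pair3 (f x) (f y) (f z).
Proof. by apply: funext => i; rewrite /pair3; case: ifP => //; case: ifP. Qed.

Lemma is_colour_piso s x y a b : I s -> In (x, a) s -> In (y, b) s ->
  is_colour x y <-> pt_colour a b.
Proof.
move=> Is hx hy.
have := piso_rel PI (r := inl (XColour S)) (v := pair2 (x, a) (y, b)) Is.
by rewrite (pair2E fst) (pair2E snd); apply => i; rewrite /pair2; case: ifP.
Qed.

Lemma is_agree_piso n s x y a b : I s -> In (x, a) s -> In (y, b) s ->
  is_agree n x y <-> pt_agree n a b.
Proof.
move=> Is hx hy.
have := piso_rel PI (r := inl (XAgree S n)) (v := pair2 (x, a) (y, b)) Is.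
by rewrite (pair2E fst) (pair2E snd); apply => i; rewrite /pair2; case: ifP.
Qed.

Lemma is_diff_piso n s x y z a b c : I s -> In (x, a) s -> In (y, b) s -> In (z, c) s ->
  is_diff n x y z <-> pt_diff n a b c.
Proof.
move=> Is hx hy hz.
have := piso_rel PI (r := inl (XDiff S n)) (v := pair3 (x, a) (y, b) (z, c)) Is.
rewrite (pair3E fst) (pair3E snd); apply => i; rewrite /pair3.
by case: ifP => // _; case: ifP.
Qed.

Definition base_interp : interp (@atom_arity S) {x | is_U x} :=
  fun r a => @rels (xsig S) B (XBase r) (fun i => sval (a i)).
Definition base_system (s : seq ({x | is_U x} * dom N)) : Prop :=
  I (map (fun p => (sval p.1, Ub p.2)) s).

(** The predicate U is preserved by the system, so partners of base points are base points on both
    sides. *)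
Lemma base_piso : piso base_interp (@holds S N) base_system.
Proof.
have inmap (s : seq ({x | is_U x} * dom N)) x m : In (x, m) s ->
    In (sval x, Ub m) (map (fun p => (sval p.1, Ub p.2)) s).
  by move=> h; apply/In_map; exists (x, m).
split.
- exact: piso_nil PI.
- move=> s [x ux] Is; have [a Ia] := piso_forth PI x Is.
  have := proj1 (is_U_piso Ia (or_introl erefl)) ux.
  by case: a Ia => // m Im _; exists m.
- move=> s m Is; have [x Ix] := piso_back PI (Ub m) Is.
  have ux : is_U x by apply/(is_U_piso Ix (or_introl erefl)).
  by exists (exist _ x ux).
- move=> s [x ux] m [y uy] m' Is /inmap h /inmap h' /=.
  have /= e := piso_eq PI Is h h'; split=> [[exy]|emm].
    by have [] := proj1 e exy.
  by apply: eq_exist; apply/e; rewrite emm.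
- move=> s r v Is hv.
  have h := piso_rel PI (r := inl (XBase r)) (v := fun i => (sval (v i).1, Ub (v i).2)) Is.
  apply: iff_trans (h _) _ => [i|]; first by apply: inmap; case: (v i) (hv i).
  by split=> [[m em hm]|hm]; [have -> : (fun i => (v i).2) = m by apply: funext => i; case: (em i)|
    exists (fun i => (v i).2)].
Qed.

Lemma branch_of x : ~ is_U x -> ~ is_P x -> forall s a, I s -> In (x, a) s ->
  exists b, a = Br b.
Proof.
move=> nU nP s a Is h; have := is_U_piso Is h; have := is_P_piso Is h.
by case: a h => [m|m|b] h /= [_ hP] [_ hU]; [case: nU; exact: hU|case: nP; exact: hP|exists b].
Qed.

Lemma agree_pt n s x y a b : I s -> In (x, a) s -> In (y, b) s -> is_agree n x y ->
  exists p q, [/\ a = Br p, b = Br q & agree n (sval p) (sval q)].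
Proof.
move=> Is hx hy /(is_agree_piso n Is hx hy).
by case: a hx => // p hx; case: b hy => // q hy h; exists p, q.
Qed.

Lemma match2 x y : exists s a b, [/\ I s, In (x, a) s & In (y, b) s].
Proof.
have [a Ia] := piso_forth PI x (piso_nil PI); have [b Ib] := piso_forth PI y Ia.
by exists [:: (y, b); (x, a)], a, b; split=> //=; [right; left|left].
Qed.

Lemma is_agree_sym n x y : is_agree n x y -> is_agree n y x.
Proof.
have [s [a [b [Is hx hy]]]] := match2 x y; move=> /(agree_pt Is hx hy)[p [q [ea eb h]]].
by apply/(is_agree_piso n Is hy hx); rewrite ea eb; exact: agree_sym.
Qed.

Lemma is_agree_trans n x y z : is_agree n x y -> is_agree n y z -> is_agree n x z.
Proof.
have [s [a [b [Is hx hy]]]] := match2 x y; have [c Ic] := piso_forth PI z Is.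
move=> /(agree_pt Is hx hy)[p [q [ea eb h]]].
move=> /(agree_pt Ic (or_intror hy) (or_introl erefl))[q' [r [eb' ec h']]].
apply/(is_agree_piso n Ic (or_intror hx) (or_introl erefl)); rewrite ea ec /=.
by apply: agree_trans h _; move: eb'; rewrite eb => -[->].
Qed.

(** Finiteness transfers by the back property: once all points supporting the two matched branches
    have partners in [B], any further point of the difference must equal one of these partners. *)
Lemma finite_diff n x y : exists l, forall z, is_diff n x y z <-> In z l.
Proof.
suff [l hl] : exists l, forall z, is_diff n x y z -> In z l.
  exists (List.filter (fun z => `[< is_diff n x y z >]) l) => z.
  rewrite List.filter_In; split=> [h|[_ /asboolP //]]; split; [exact: hl|exact/asboolP].
have [s [a [b [Is hx hy]]]] := match2 x y.
have [[p [q [ea eb]]]|no] := EM (exists p q, a = Br p /\ b = Br q); last first.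
  exists [::] => z; have [c Ic] := piso_forth PI z Is.
  rewrite (is_diff_piso n Ic (or_intror hx) (or_intror hy) (or_introl erefl)).
  by case: a b hx hy no {Ic} => [?|?|p] [?|?|q] // _ _ []; exists p, q.
have [L hL] := branch_support p; have [L' hL'] := branch_support q.
have [s' [Is' ss' hs']] := piso_list_back (map (@Ub _) (L ++ L')) PI Is.
exists (map fst s') => z; have [c Ic] := piso_forth PI z Is'.
have hx' : In (x, a) ((z, c) :: s') by right; exact: ss'.
have hy' : In (y, b) ((z, c) :: s') by right; exact: ss'.
rewrite (is_diff_piso n Ic hx' hy' (or_introl erefl)) ea eb.
case: c Ic {hx' hy'} => // m Im [_ d].
have [w hw] : exists w, In (w, Ub m) s'.
  apply: hs'; apply/In_map; exists m => //; apply/List.in_app_iff; move: d.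
  case pm : (sval p n m) => /= d; first by left; apply: hL pm.
  by right; apply: hL' d.
apply/In_map; exists (w, Ub m) => //=.
by apply/(piso_eq PI Im (or_introl erefl) (or_intror hw)).
Qed.

Lemma diff_U n x y z : is_diff n x y z -> is_U z.
Proof.
have [s [a [b [Is hx hy]]]] := match2 x y; have [c Ic] := piso_forth PI z Is.
move=> /(is_diff_piso n Ic (or_intror hx) (or_intror hy) (or_introl erefl)) h.
apply/(is_U_piso Ic (or_introl erefl)).
by case: a b c h {hx hy Ic} => [?|?|p] [?|?|q] [?|?|?].
Qed.

(** Parity: a point lies in none or in exactly two of the three symmetric differences of three sets.
    [diff_split] is the complementary half. *)
Lemma diff_excl n x y z w : is_diff n x y w -> is_diff n z x w -> ~ is_diff n z y w.
Proof.
have [s [a [b [Is hx hy]]]] := match2 x y; have [c Ic] := piso_forth PI z Is.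
have [d Id] := piso_forth PI w Ic.
have hx' : In (x, a) ((w, d) :: (z, c) :: s) by right; right.
have hy' : In (y, b) ((w, d) :: (z, c) :: s) by right; right.
have hz : In (z, c) ((w, d) :: (z, c) :: s) by right; left.
have hw : In (w, d) ((w, d) :: (z, c) :: s) by left.
rewrite (is_diff_piso n Id hx' hy' hw) (is_diff_piso n Id hz hx' hw).
rewrite (is_diff_piso n Id hz hy' hw).
case: a b c d {hx hy hx' hy' hz hw Ic Id} => [?|?|p] [?|?|q] [?|?|r] [m|?|?] //=.
by move=> [_ e1] [_ e2] [_ e3]; move: e1 e2 e3; case: (sval p n m); case: (sval q n m);
  case: (sval r n m).
Qed.

Lemma diff_split n x y z w : is_agree n z x -> is_agree n z y -> is_diff n x y w ->
  is_diff n z x w \/ is_diff n z y w.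
Proof.
have [s [a [b [Is hx hy]]]] := match2 x y; have [c Ic] := piso_forth PI z Is.
have [d Id] := piso_forth PI w Ic.
have hx' : In (x, a) ((w, d) :: (z, c) :: s) by right; right.
have hy' : In (y, b) ((w, d) :: (z, c) :: s) by right; right.
have hz : In (z, c) ((w, d) :: (z, c) :: s) by right; left.
have hw : In (w, d) ((w, d) :: (z, c) :: s) by left.
rewrite (is_agree_piso n Id hz hx') (is_agree_piso n Id hz hy').
rewrite (is_diff_piso n Id hx' hy' hw) (is_diff_piso n Id hz hx' hw).
rewrite (is_diff_piso n Id hz hy' hw).
case: a b c d {hx hy hx' hy' hz hw Ic Id} => [?|?|p] [?|?|q] [?|?|r] [m|?|?] //=.
move=> h h' [_ e]; case e1 : (sval r n m (+) sval p n m); first by left.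
by right; split=> //; move: e e1; case: (sval p n m); case: (sval q n m); case: (sval r n m).
Qed.

Lemma branches_split x y : ~ is_U x -> ~ is_P x -> ~ is_U y -> ~ is_P y -> x <> y ->
  exists n w, is_agree n x y /\ is_diff n x y w.
Proof.
move=> xU xP yU yP ne; have [s [a [b [Is hx hy]]]] := match2 x y.
have [p ea] := branch_of xU xP Is hx; have [q eb] := branch_of yU yP Is hy.
have npq : p <> q.
  by move=> e; apply: ne; apply/(piso_eq PI Is hx hy); rewrite ea eb e.
have [n [m [h d]]] := branch_split npq; have [w Iw] := piso_back PI (Ub m) Is.
exists n, w; split; first by apply/(is_agree_piso n Is hx hy); rewrite ea eb.
apply/(is_diff_piso n Iw (or_intror hx) (or_intror hy) (or_introl erefl)).
by rewrite ea eb.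
Qed.

Lemma colour_ex y : is_P y -> exists x, [/\ ~ is_U x, ~ is_P x & is_colour x y].
Proof.
have [b Ib] := piso_forth PI y (piso_nil PI).
move=> /(is_P_piso Ib (or_introl erefl)); case: b Ib => // c Ic _.
have [p hp] := branch_colour_ex c; have [x Ix] := piso_back PI (Br p) Ic.
have hx : In (x, Br p) [:: (x, Br p); (y, Pt c)] by left.
have hy : In (y, Pt c) [:: (x, Br p); (y, Pt c)] by right; left.
exists x; split; first by move=> /(is_U_piso Ix hx).
  by move=> /(is_P_piso Ix hx).
exact/(is_colour_piso Ix hx hy).
Qed.

Lemma is_colour_uniq x y y' : is_colour x y -> is_colour x y' -> y = y'.
Proof.
have [s [b [b' [Is hy hy']]]] := match2 y y'; have [a Ia] := piso_forth PI x Is.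
move=> /(is_colour_piso Ia (or_introl erefl) (or_intror hy)) h.
move=> /(is_colour_piso Ia (or_introl erefl) (or_intror hy')) h'.
apply/(piso_eq PI Is hy hy'); case: a b b' h h' {Is hy hy' Ia} => // p [] // c [] // c' h h'.
by rewrite (colour_uniq h h').
Qed.

(* Relative to a representative of each class of [is_agree n], a branch is coded by a
   sequence of finite subsets of the base. *)
Lemma branches_bounded : card_le {x | is_U x} K ->
  exists v : dom B -> nat -> K, forall x y, ~ is_U x -> ~ is_P x -> ~ is_U y -> ~ is_P y ->
    v x = v y -> x = y.
Proof.
move=> [u uI]; have [i iI] := iK; have [g gI] := card_le_seq.
pose u' x := if pselect (is_U x) is left h then u (exist _ x h) else i 0.
have u'I x y : is_U x -> is_U y -> u' x = u' y -> x = y.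
  by move=> ux uy; rewrite /u'; case: pselect => // ux'; case: pselect => // uy' /uI[].
pose choose (P : dom B -> Prop) := if pselect (exists y, P y) is left h then sval (cid h)
  else dom_inh B.
have chooseP (P : dom B -> Prop) y : P y -> P (choose P).
  by move=> py; rewrite /choose; case: pselect => [h|[]]; [case: cid|exists y].
have /choice[l hl] : forall t : dom B * nat, exists l, forall z,
    is_diff t.2 (choose (is_agree t.2 t.1)) t.1 z <-> In z l by move=> t; exact: finite_diff.
exists (fun x n => g (map u' (l (x, n)))) => x y xU xP yU yP e.
apply: contrapT => /(branches_split xU xP yU yP)[n [w [axy dxy]]].
(* [choose] depends only on the predicate, so equality of the two classes gives [x] and [y] the same
   representative at level [n]. *)
have eP : is_agree n x = is_agree n y.
  apply: funext => z; apply: propext; split; last exact: is_agree_trans.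
  by apply: is_agree_trans; exact: is_agree_sym.
pose z := choose (is_agree n x).
have axz : is_agree n x z by apply: chooseP axy.
have ayz : is_agree n y z by rewrite -eP.
have el : map u' (l (x, n)) = map u' (l (y, n)) by apply: gI; have := congr1 (fun h => h n) e.
have dx m : is_diff n z x m <-> In m (l (x, n)) by exact: (hl (x, n)).
have dy m : is_diff n z y m <-> In m (l (y, n)) by rewrite /z eP; exact: (hl (y, n)).
have transport m l1 l2 a b : (forall m, is_diff n z a m <-> In m l1) ->
    (forall m, is_diff n z b m <-> In m l2) -> map u' l1 = map u' l2 ->
    is_diff n z a m -> is_diff n z b m.
  move=> h1 h2 e12 hm.
  have : In (u' m) (map u' l1) by apply/In_map; exists m => //; apply/h1.
  rewrite e12 => /In_map[m' /h2 hm' /u'I eu].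
  by rewrite eu //; [exact: diff_U hm|exact: diff_U hm'].
have azx := is_agree_sym axz; have azy := is_agree_sym ayz.
(* The point [w] separating [x] from [y] separates one of them from [z]; equal codes make it
   separate both from [z], against parity. *)
have [h|h] := diff_split azx azy dxy.
  exact: (diff_excl dxy h (transport _ _ _ _ _ dx dy el h)).
exact: (diff_excl dxy (transport _ _ _ _ _ dy dx (esym el) h) h).
Qed.

Theorem expansion_bounded : card_le {x | is_U x} K -> card_le (dom B) K.
Proof.
move=> hU; have [v vI] := branches_bounded hU; have [u uI] := hU.
have [i iI] := iK; have [f fI] := powK.
have /choice[b hb] : forall y, exists x, is_P y -> [/\ ~ is_U x, ~ is_P x & is_colour x y].
  by move=> y; have [/colour_ex[x hx]|nP] := EM (is_P y); [exists x|exists y].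
(* Entry 0 is a tag distinguishing base, P and branches. A point of P is coded by a branch [b x]
   having it as colour. *)
pose code x n := if pselect (is_U x) is left h then
    (if n is 0 then i 0 else u (exist _ x h)) else
  if pselect (is_P x) is left _ then (if n is n'.+1 then v (b x) n' else i 1)
  else (if n is n'.+1 then v x n' else i 2).
suff cI : injective code by exists (f \o code); apply: inj_comp.
move=> x y e; have e0 := congr1 (fun h => h 0) e; have eS n := congr1 (fun h => h n.+1) e.
move: e0 eS; rewrite /code /=.
case: (pselect (is_U x)) => ux; case: (pselect (is_U y)) => uy.
- by move=> _ /(_ 0)/uI[].
- by case: pselect => _ h; have := iI _ _ h.
- by case: pselect => _ h; have := iI _ _ h.
case: (pselect (is_P x)) => px; case: (pselect (is_P y)) => py; try by move=> h; have := iI _ _ h.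
- move=> _ eS; have [xU xP xc] := hb _ px; have [yU yP yc] := hb _ py.
  by apply: is_colour_uniq xc _; rewrite (vI _ _ xU xP yU yP) //; apply: funext.
- by move=> _ eS; apply: vI => //; apply: funext.
Qed.

Theorem base_bounded (sigma : formula S) : enumerated (dom N) -> sentence sigma ->
  models N sigma ->
  (forall L : Type, is_succ_card K L ->
     ~ exists M : structure S, models M sigma /\ card_eq (dom M) L) ->
  card_le {x | is_U x} K.
Proof.
move=> [e se] ss Ns nosucc; apply: contrapT => nK.
have PU := base_piso; pose J := base_system; pose X := {x | is_U x}.
have [x0 _] : exists x : X, True.
  apply: contrapT => no; apply: nK; have [i _] := iK.
  by exists (fun=> i 0) => x; case: no; exists x.
have /choice[c' hc] : forall t : seq (X * dom N) * nat, exists x, J t.1 -> J ((x, e t.2) :: t.1).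
  move=> t; have [Jt|nJ] := EM (J t.1); last by exists x0.
  by have [x Jx] := piso_back PU (e t.2) Jt; exists x.
have [D [succD closedD]] := successor_hull iK card_le_seq se (fun s j => c' (s, j)) nK.
pose emb (s : seq ({x | D x} * dom N)) := map (fun p => (sval p.1, p.2)) s.
have inemb s x m : In (x, m) s -> In (sval x, m) (emb s) by move=> h; apply/In_map; exists (x, m).
(* Closure under [c'] keeps the witnesses of the back property inside [D]; those of the forth
   property lie in [N] and are unaffected. *)
have PD : piso (fun r (a : 'I_(atom_arity r) -> {x | D x}) => base_interp (fun i => sval (a i)))
    (@holds S N) (fun s => J (emb s)).
  split.
  - exact: piso_nil PU.
  - by move=> s [x dx] Js; have [m Jm] := piso_forth PU x Js; exists m.
  - move=> s m Js; have [j ej] := se m.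
    have dx : D (c' (emb s, j)) by apply: closedD => p /In_map[q _ ->]; exact: svalP q.1.
    by exists (exist _ _ dx); rewrite -ej; exact: (hc (emb s, j)).
  - move=> s [x dx] m [y dy] m' Js /inemb h /inemb h'.
    rewrite -(piso_eq PU Js h h') /=; split=> [[]//|exy]; exact: eq_exist.
  - move=> s r v Js hv.
    apply: (piso_rel PU (v := fun i => (sval (v i).1, (v i).2)) Js) => i.
    by apply: inemb; case: (v i) (hv i).
have [d0] : inhabited {x | D x}.
  apply: contrapT => no; case: succD => -[[f _] _] _; have [i _] := iK.
  by apply: no; exact: inhabits (f (i 0)).
have [A [J' [cA PA]]] := structure_of_piso d0 PD.
by apply: (nosucc _ succD); exists A; split=> //; apply/(piso_models PA ss).
Qed.

End Bound.

(** * The homogeneous characterization of [K] *)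

Theorem theorem2p11 (K : Type) :
  infinite_type K ->
  completely_characterizable K ->
  card_eq (nat -> K) K ->
  homogeneously_characterizable K.
Proof.
move=> iK [S [sigma [[ss complete] [spectrum nosucc]]]] [f fb].
have powK : card_le (nat -> K) K by exists f; exact: bij_inj.
have [N [Ns cN]] := spectrum nat (ex_intro _ id (fun _ _ => id)) iK.
have [MK [MKs cMK]] := spectrum K iK (ex_intro _ id (fun _ _ => id)).
have eN := card_eq_nat_enumerated cN; have [e se] := eN.
have iN : infinite_type (dom N) by case: cN => g [h gh hg]; exists h; exact: can_inj hg.
(* The Scott sentence of [N] holds in [N], so the complete sentence [sigma] cannot imply its
   negation and must imply it; hence it holds in [MK]. *)
have [I0 P0] : exists I, @piso_struct S MK N I.
  have [theta [st thP]] := scott_sentence se; apply/thP.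
  have Nth : models N theta by apply/thP; eexists; exact: identity_piso.
  have [h|h] := complete theta st; first exact: h.
  by case: (h N Ns (fun=> dom_inh N)); apply: Nth.
have ePN := point_enumerated eN; have [e' se'] := ePN.
have [phi [sphi phiP]] := @scott_sentence (xsig S) (expansion N) e' se'.
exists (xsig S), phi, (XP S); split=> //; split; last split; last split; last split.
(* All models of [phi] are back-and-forth equivalent to the expansion of [N], so the truth value of
   [tau] there decides it. *)
- split=> // tau st; have [h|h] := EM (models (expansion N) tau); [left|right] => B /phiP[I PI].
    by apply/(piso_models PI st).
  by move=> r hr; apply: h; apply/(piso_models PI st); exact: sentence_sat hr.
- move=> B /phiP[I PI] [_]; apply; apply: (expansion_bounded iK powK PI).
  exact: (base_bounded iK powK PI eN ss Ns nosucc).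
- exists (expansion N); split; last exact: enumerated_card_eq (infinite_point iN) ePN.
  by apply/phiP; eexists; exact: identity_piso.
- move=> B /phiP[I PI] /card_eq_nat_enumerated eB; exact: homogeneous_models PI.
(* The same system serves for the base and for its bare copy; here P is a copy of [MK], which has
   the size of [K]. *)
- exists (expansion MK); split; first by apply/phiP; eexists; exact: (lifted_piso P0 P0).
  case: cMK => g [g' gK g'K].
  have /choice[h hh] : forall t : {x | @pred_interp (xsig S) (expansion MK) (XP S) x},
    exists m, sval t = Pt m by case=> x px; case: x px => [m []|m px|m []]; exists m.
  exists (g \o h); apply: bij_comp; first by exists g'.
  exists (fun m => exist (@pred_interp (xsig S) (expansion MK) (XP S)) (Pt m) I) => [t|m].
    by case: t (hh t) => x px /= ex; apply: eq_exist; exact: esym ex.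
  by have := hh (exist _ (Pt m) I) => -[].
Qed.
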